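(* Let $n\in\mathbb{N}$, $n\geq 1$, and $d\in\mathbb{N}\cup\{0\}$. For a holomorphic map $f:\mathbb{C}\to\mathbb{C}^n$ let $J_d(f):\mathbb{C}\to\mathbb{C}^{n(d+1)}$ be defined as $J_d(f)=(f,f',f'',\ldots,f^{(d)})$. Let $\Phi_d\subset \mathrm{Hol}(\mathbb{C},\mathbb{C}^n)$ be the set of all holomorphic maps $f$ from $\mathbb{C}$ to $\mathbb{C}^n$ for which $\overline{(J_d f)(\mathbb{C})}=\mathbb{C}^{n(d+1)}$. Then $\Phi_d$ is dense in $\mathrm{Hol}(\mathbb{C},\mathbb{C}^n)$ with respect to the topology of locally uniform convergence.
   Context: $\mathrm{Hol}(\mathbb{C},\mathbb{C}^n)$ denotes the set of all holomorphic maps from $\mathbb{C}$ to $\mathbb{C}^n$, and $f^{(k)}$ denotes the $k$-th derivative of $f$. *)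

(* Defs.v *)
From HB Require Import structures.
From mathcomp Require Import all_boot all_order all_algebra.
From mathcomp Require Import complex.
From mathcomp Require Import boolp classical_sets functions reals.
From mathcomp Require Import topology normedtype derive.

Set Implicit Arguments.
Unset Strict Implicit.
Unset Printing Implicit Defensive.

Import Order.TTheory GRing.Theory Num.Theory.
Import numFieldNormedType.Exports.

Local Open Scope classical_set_scope.
Local Open Scope ring_scope.

(* R[i] is packed as a numFieldType: the library attaches its topology and norm
   to the carriers of such structures, not to the concrete type R[i]. *)
Definition Cplx (R : realType) : numFieldType := R[i].

Definition holomorphic (R : realType) (n : nat) (f : Cplx R -> 'rV[Cplx R]_n) :=
  forall z, derivable f z 1.

Definition hol_incl (R : realType) (n : nat)
    (f : [set f : Cplx R -> 'rV[Cplx R]_n | holomorphic f]) :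
  {family compact, Cplx R -> 'rV[Cplx R]_n} := sval f.

(* Holomorphic maps with the topology of locally uniform convergence. As the
   complex plane is locally compact, this is uniform convergence on compacts;
   the initial topology of the inclusion is the subspace topology. *)
Definition Hol (R : realType) (n : nat) : topologicalType :=
  initial_topology (@hol_incl R n).

(* mxvec concatenates the rows f z, f' z, ..., f^(d) z, in this order. *)
Definition jet (R : realType) (n d : nat) (f : Cplx R -> 'rV[Cplx R]_n)
    (z : Cplx R) : 'rV[Cplx R]_(d.+1 * n) :=
  mxvec (\matrix_(k < d.+1) (f^`(k))%classic z).

Definition Phi (R : realType) (n d : nat) : set (Hol R n) :=
  [set f | closure (range (jet d (hol_incl f))) = setT].

(* Main.v *)
Require Import Defs.
From mathcomp Require Import all_boot all_order all_algebra.
From mathcomp Require Import boolp classical_sets reals topology.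
From mathcomp Require Import complex functions normedtype sequences derive.
From mathcomp Require Import ring lra.

Set Implicit Arguments.
Unset Strict Implicit.
Unset Printing Implicit Defensive.

Import Order.TTheory GRing.Theory Num.Theory.
Import numFieldNormedType.Exports.

Local Open Scope classical_set_scope.
Local Open Scope ring_scope.


(** Density is proved by the classical gluing argument. Given an entire
    [f], a disc and a tolerance, first replace each coordinate of [f] by a
    polynomial, close to it on the disc; then add polynomial corrections one
    after the other. The [N]-th correction is tiny on a disc of radius about
    [s * N], while at a point [a N] just outside that disc it makes the
    [d]-jet of the partial sum equal to the [N]-th term of a sequence of
    targets that visits every rational jet infinitely often. Since [a N] lies
    well inside the discs of all later corrections, the jet of the limit at [a
    N] differs little from the target, so the jets of the limit are dense; and
    the limit stays close to [f] on the given disc.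

    Corrections ([jet_interp]) are built by induction on the order of the jet,
    from multiples of [X ^ N (X - a) ^ d]: prescribing the [d]-th derivative
    at [a] forces a coefficient of size [|a| ^ - N], which beats [rho ^ N].
    Their size is measured by the weighted coefficient norm [coef_norm rho],
    the sum of [|c_i| rho ^ i]: it controls derivatives ([coef_norm_derivn])
    and Taylor remainders ([horner_taylor]) on discs by elementary algebra, so
    that [polynomial_series_limit] can differentiate the sum of the
    corrections term by term to all orders without any integral formula.

    The analytic core is [poly_approx]: a function that is merely complex
    differentiable at every point is a uniform limit of polynomials on discs.
    It is obtained from Landau's kernel [(1 - (u / T) ^ 2) ^ n]. The weighted
    average of [f t], with weight [(1 - ((z - t) / T) ^ 2) ^ n] for [t] in the
    real segment [-T, T], is a polynomial in [z] whatever [f] is. By Goursat's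
    lemma on the parallelogram with vertices [-T], [T], [z + T], [z - T], this
    average equals the average over the segment centred at [z], up to the two
    sides parallel to [z], where the kernel is exponentially smaller than the
    mass of the average; and over the segment centred at [z] the kernel is
    real, nonnegative and concentrates at [z], so the average tends to [f z].

    Integrals along segments are represented by midpoint sums over [2 ^ M]
    pieces, which are exactly additive under halving and exact on affine
    functions. This is all that the subdivision proof of Goursat's lemma uses
    ([discrete_goursat]). *)

(** * Moduli of complex numbers *)
Section Modulus.
Variable R : realType.
Local Notation C := (Cplx R).
Implicit Types (z w : C) (x y : R).

(** The norm of the complex numbers takes its values in the complex numbers;
    [cmod] is the same modulus with values in [R], where order and
    linear arithmetic are available. *)
Definition cmod z : R := ComplexField.Normc.normc (z : R[i]).
Definition rc x : C := (x%:C)%C.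

Lemma normE z : `|z| = rc (cmod z). Proof. by []. Qed.

Lemma cmod_ge0 z : 0 <= cmod z.
Proof. by case: z => a b; exact: sqrtr_ge0. Qed.

Lemma cmodD z w : cmod (z + w) <= cmod z + cmod w.
Proof. exact: le_normcD. Qed.

Lemma cmodN z : cmod (- z) = cmod z.
Proof. exact: normcN. Qed.

Lemma cmodM z w : cmod (z * w) = cmod z * cmod w.
Proof. exact: ComplexField.Normc.normcM. Qed.

Lemma rcD x y : rc (x + y) = rc x + rc y.
Proof. exact: (rmorphD (real_complex R)). Qed.
Lemma rcN x : rc (- x) = - rc x.
Proof. exact: (rmorphN (real_complex R)). Qed.
Lemma rcM x y : rc (x * y) = rc x * rc y.
Proof. exact: (rmorphM (real_complex R)). Qed.
Lemma rcV x : rc (x^-1) = (rc x)^-1.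
Proof. exact: (fmorphV (real_complex R)). Qed.
Lemma rcX x n : rc (x ^+ n) = rc x ^+ n.
Proof. exact: (rmorphXn (real_complex R)). Qed.
Lemma rc_nat n : rc n%:R = n%:R.
Proof. exact: (rmorph_nat (real_complex R)). Qed.
Lemma rc0 : rc 0 = 0. Proof. by []. Qed.
Lemma rc1 : rc 1 = 1. Proof. by []. Qed.

Lemma rc_lt x y : (rc x < rc y) = (x < y). Proof. exact: ltcR. Qed.

Lemma cmod_rc x : cmod (rc x) = `|x|.
Proof. by rewrite /cmod /= expr0n /= addr0 sqrtr_sqr. Qed.

Lemma cmod0 : cmod 0 = 0. Proof. by rewrite -rc0 cmod_rc normr0. Qed.
Lemma cmod1 : cmod 1 = 1. Proof. by rewrite -rc1 cmod_rc normr1. Qed.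
Lemma cmod_nat n : cmod n%:R = n%:R.
Proof. by rewrite -rc_nat cmod_rc ger0_norm. Qed.
Lemma cmodV z : cmod z^-1 = (cmod z)^-1.
Proof. exact: ComplexField.Normc.normcV. Qed.
Lemma cmodX z n : cmod (z ^+ n) = cmod z ^+ n.
Proof. by elim: n => [|n IH]; rewrite ?cmod1 // !exprS cmodM IH. Qed.
Lemma cmod_eq0 z : (cmod z == 0) = (z == 0).
Proof.
apply/eqP/eqP => [h|->]; last exact: cmod0.
exact: ComplexField.eq0_normC (congr1 rc h).
Qed.
Lemma cmod_gt0 z : (0 < cmod z) = (z != 0).
Proof. by rewrite lt_neqAle cmod_ge0 andbT eq_sym cmod_eq0. Qed.

Lemma cmod_sum (I : Type) (r : seq I) (P : pred I) (F : I -> C) :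
  cmod (\sum_(i <- r | P i) F i) <= \sum_(i <- r | P i) cmod (F i).
Proof.
apply: (big_ind2 (fun u v => cmod u <= v)) => [|u1 v1 u2 v2 h1 h2|//].
  by rewrite cmod0.
by apply: le_trans (cmodD _ _) _; exact: lerD.
Qed.

Lemma cmodB z w : cmod (z - w) = cmod (w - z).
Proof. by rewrite -cmodN opprB. Qed.

Lemma Re_le_cmod (z : C) : `|complex.Re z| <= cmod z.
Proof.
case: z => a b; rewrite /cmod /= -sqrtr_sqr ler_wsqrtr // lerDl; exact: sqr_ge0.
Qed.
Lemma Im_le_cmod (z : C) : `|complex.Im z| <= cmod z.
Proof.
case: z => a b; rewrite /cmod /= -sqrtr_sqr ler_wsqrtr // lerDr; exact: sqr_ge0.
Qed.
Lemma cmod_le_ReIm (z : C) : cmod z <= `|complex.Re z| + `|complex.Im z|.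
Proof.
have {1}-> : z = rc (complex.Re z) + ('i%C : C) * rc (complex.Im z).
  exact: complexE.
apply: le_trans (cmodD _ _) _; rewrite cmodM !cmod_rc.
by rewrite [cmod 'i%C]/cmod /= expr0n expr1n /= add0r sqrtr1 mul1r.
Qed.

Lemma ball_cmod (z : C) (e : R) (w : C) : ball z (rc e) w <-> cmod (z - w) < e.
Proof. by rewrite -ball_normE /ball_ /= normE rc_lt. Qed.

Lemma pos_cplx_real (e : C) : 0 < e -> exists2 x : R, 0 < x & e = rc x.
Proof.
move=> e0; exists (complex.Re e).
  by move: e0; rewrite ltcE => /andP[].
by rewrite /rc RRe_real // gtr0_real.
Qed.

(** Turns the filters of the complex plane into real epsilon-delta statements. *)
Lemma nbhs_cmodP (z : C) (A : set C) :
  nbhs z A <-> exists2 e : R, 0 < e & forall w, cmod (w - z) < e -> A w.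
Proof.
split.
  move=> /nbhs_ballP[e /= /pos_cplx_real[x x0 ->] h]; exists x => // w hw.
  by apply: h; apply/ball_cmod; rewrite cmodB.
move=> [e e0 h]; apply/nbhs_ballP; exists (rc e) => /=; first by rewrite -rc0 rc_lt.
by move=> w /ball_cmod; rewrite cmodB; exact: h.
Qed.

Lemma geometric_eventually_lt (q D e : R) : 0 <= q < 1 -> 0 < e ->
  exists n0, forall n, (n0 <= n)%N -> D * q ^+ n < e.
Proof.
move=> /andP[q0 q1] e0; have := @cvg_geometric R D q.
rewrite ger0_norm // => /(_ q1)/cvgr0_norm_lt/(_ _ e0)[n0 _ hn0].
exists n0 => n hn; apply: le_lt_trans (hn0 n hn).
exact: ler_norm.
Qed.

(** The lower bounds [x k - 2 D / 2 ^ k] increase and the upper bounds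
    [x k + 2 D / 2 ^ k] decrease, so the supremum of the former lies between
    them at every rank. *)
Lemma real_geom_lim (x : nat -> R) (D : R) :
  (forall k, `|x k.+1 - x k| <= D / 2 ^+ k) ->
  exists s, forall k, `|s - x k| <= 2 * D / 2 ^+ k.
Proof.
move=> hx; pose e k := 2 * D / 2 ^+ k.
have eS k : e k = e k.+1 + D / 2 ^+ k.
  by rewrite /e exprS; field; rewrite expf_neq0 ?pnatr_eq0.
have D0 : 0 <= D by have := le_trans (normr_ge0 _) (hx 0); rewrite expr0 divr1.
have e0 k : 0 <= e k by rewrite /e !mulr_ge0 // invr_ge0 exprn_ge0.
have lo k m : x k - e k <= x (m + k)%N - e (m + k)%N.
  elim: m => // m IH; apply: le_trans IH _; rewrite addSn.
  by have := hx (m + k)%N; have := eS (m + k)%N; rewrite ler_norml => h /andP[]; lra.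
have hi k m : x (m + k)%N + e (m + k)%N <= x k + e k.
  elim: m => // m IH; apply: le_trans IH; rewrite addSn.
  by have := hx (m + k)%N; have := eS (m + k)%N; rewrite ler_norml => h /andP[]; lra.
have lohi k j : x k - e k <= x j + e j.
  by have := lo k j; have := hi j k; rewrite addnC; have := e0 (j + k)%N; lra.
pose E := [set x k - e k | k in [set: nat]].
have nE : E !=set0 by exists (x 0 - e 0); exists 0.
exists (sup E) => k; rewrite -/(e k) ler_norml; apply/andP; split.
  suff : x k - e k <= sup E by lra.
  apply: ub_le_sup; last by exists k.
  by exists (x 0 + e 0) => _ [j _ <-].
suff : sup E <= x k + e k by lra.
by apply: ge_sup => // _ [j _ <-].
Qed.

(** Completeness of the complex plane in the only form used here: steps that
    decay geometrically, with an explicit rate for the limit.  It serves both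
    to find the limit point of nested parallelograms and to sum series. *)
Lemma cplx_geom_lim (a : nat -> C) (D : R) :
  (forall k, cmod (a k.+1 - a k) <= D / 2 ^+ k) ->
  exists w, forall k, cmod (w - a k) <= 4 * D / 2 ^+ k.
Proof.
move=> ha.
have [|x hx] := @real_geom_lim (fun k => complex.Re (a k)) D.
  move=> k; apply: le_trans (ha k); apply: le_trans (Re_le_cmod _).
  by case: (a k) (a k.+1) => [? ?] [? ?].
have [|y hy] := @real_geom_lim (fun k => complex.Im (a k)) D.
  move=> k; apply: le_trans (ha k); apply: le_trans (Im_le_cmod _).
  by case: (a k) (a k.+1) => [? ?] [? ?].
exists (Complex x y) => k; apply: le_trans (cmod_le_ReIm _) _.
have -> : 4 * D / 2 ^+ k = 2 * D / 2 ^+ k + 2 * D / 2 ^+ k by ring.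
by apply: lerD; [move: (hx k)|move: (hy k)]; case: (a k).
Qed.

Lemma derivable_linear_approx (f : C -> C) z : derivable f z 1 ->
  exists l : C, forall e : R, 0 < e -> exists2 d : R, 0 < d &
    forall w, cmod (w - z) < d -> cmod (f w - f z - l * (w - z)) <= e * cmod (w - z).
Proof.
move=> /cvg_ex[/= l hl]; exists l => e e0.
have /hl : nbhs (l : C) (ball (l : C) (rc e)) by apply: nbhsx_ballx; rewrite -rc0 rc_lt.
rewrite /nbhs /= => /nbhs_ballP[_ /= /pos_cplx_real[d d0 ->] h].
exists d => // w hw; have [->|wz] := eqVneq w z.
  by rewrite !subrr mulr0 subr0 cmod0 mulr0.
have wz0 : w - z != 0 by rewrite subr_eq0.
have := h (w - z); rewrite /= => /(_ _ _)/ball_cmod.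
have -> : ((w - z) *: (1 : C) + z) = w by rewrite /GRing.scale /= mulr1 subrK.
move=> /(_ _ wz0) H.
have {}H : cmod (l - (w - z)^-1 *: (f w - f z)) < e.
  by apply: H; apply/ball_cmod; rewrite sub0r cmodN.
have -> : f w - f z - l * (w - z) = - ((l - (w - z)^-1 *: (f w - f z)) * (w - z)).
  by rewrite /GRing.scale /=; field.
by rewrite cmodN cmodM ler_wpM2r ?cmod_ge0 // ltW.
Qed.

End Modulus.

(** * A discrete Goursat lemma *)

Section Goursat.
Variable R : realType.
Local Notation C := (Cplx R).
Implicit Types (g : C -> C) (a u v : C).

Definition node (N j : nat) : R := (2 * j + 1)%:R / (2 * N)%:R.

(** The midpoint rule for the integral of [g] along the segment from [a] to
    [a + u].  Midpoints make the rule exact on affine functions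
    ([midpoint_sum_affine]) and exactly additive under halving
    ([midpoint_sum_double]). *)
Definition midpoint_sum g a u N : C :=
  u / N%:R * \sum_(j < N) g (a + u * rc (node N j)).

(** Discrete contour integral around the parallelogram with corner [a] and
    edge vectors [u] and [v]. *)
Definition boundary_sum g a u v N : C :=
  midpoint_sum g a u N + midpoint_sum g (a + u) v N
  - midpoint_sum g (a + v) u N - midpoint_sum g a v N.

Lemma node_ge0 N j : 0 <= node N j.
Proof. by rewrite /node divr_ge0. Qed.

Lemma node_le1 N j : (j < N)%N -> node N j <= 1.
Proof.
move=> jN; rewrite /node ler_pdivrMr; last first.
  by rewrite ltr0n muln_gt0 /=; apply: leq_ltn_trans jN.
by rewrite mul1r ler_nat addn1 ltn_pmul2l.
Qed.

Lemma midpoint_sum_double g a u N : 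
  midpoint_sum g a u (N + N) = midpoint_sum g a (u / 2) N + midpoint_sum g (a + u / 2) (u / 2) N.
Proof.
have [->|] := eqVneq N 0%N; first by rewrite /midpoint_sum !big_ord0 !mulr0 addr0.
move: N => n N0; have n0 : (n%:R : R) != 0 by rewrite pnatr_eq0.
have n0C : (n%:R : C) != 0 by rewrite pnatr_eq0.
have nn : (n + n)%:R = 2 * n%:R :> C by rewrite natrD mulr_natl mulr2n.
rewrite /midpoint_sum big_split_ord /= mulrDr; congr (_ + _).
  congr (_ * _); first by rewrite nn; field.
  apply: eq_bigr => j _; congr (g (_ + _)).
  have -> : node (n + n) j = node n j / 2.
    by rewrite /node addnn -mul2n !natrM; field.
  by rewrite rcM rcV rc_nat; field.
congr (_ * _); first by rewrite nn; field.
apply: eq_bigr => j _; rewrite -addrA; congr (g (_ + _)).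
have -> : node (n + n) (n + j) = 2^-1 + node n j / 2.
  by rewrite /node addnn -mul2n !(natrM, natrD); field.
by rewrite rcD rcM rcV rc_nat; field.
Qed.

(** In the four half-size parallelograms every interior edge is travelled
    twice, in opposite directions. *)
Lemma boundary_sum_double g a u v N : boundary_sum g a u v (N + N) =
  boundary_sum g a (u / 2) (v / 2) N + boundary_sum g (a + u / 2) (u / 2) (v / 2) N
  + boundary_sum g (a + v / 2) (u / 2) (v / 2) N
  + boundary_sum g (a + u / 2 + v / 2) (u / 2) (v / 2) N.
Proof.
have E x : x = x / 2 + x / 2 :> C by field.
rewrite /boundary_sum !midpoint_sum_double.
have -> : a + u = a + u / 2 + u / 2 by rewrite {1}(E u) addrA.
have -> : a + v = a + v / 2 + v / 2 by rewrite {1}(E v) addrA.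
have -> : a + v / 2 + u / 2 = a + u / 2 + v / 2 by ring.
have -> : a + v / 2 + v / 2 + u / 2 = a + u / 2 + v / 2 + v / 2 by ring.
have -> : a + u / 2 + u / 2 + v / 2 = a + u / 2 + v / 2 + u / 2 by ring.
ring.
Qed.

Lemma sum_odd N : \sum_(j < N) ((2 * j + 1)%:R : R) = N%:R ^+ 2.
Proof.
elim: N => [|N IH]; first by rewrite big_ord0 expr0n.
by rewrite big_ord_recr /= IH natrD natrM -natr1; ring.
Qed.

Lemma midpoint_sum_affine (x y : C) a u N : (0 < N)%N ->
  midpoint_sum (fun z => x + y * z) a u N = u * (x + y * (a + u / 2)).
Proof.
move=> N0; have n0 : (N%:R : C) != 0 by rewrite pnatr_eq0 -lt0n.
have n0R : (N%:R : R) != 0 by rewrite pnatr_eq0 -lt0n.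
have S : \sum_(j < N) rc (node N j) = N%:R / 2.
  have -> : \sum_(j < N) rc (node N j) = rc (\sum_(j < N) node N j).
    by apply: (big_ind2 (fun s t => s = rc t)) => // ? ? ? ? -> ->; rewrite rcD.
  rewrite /node -mulr_suml sum_odd -rc_nat -(rc_nat _ 2) -rcV -rcM; congr rc.
  by rewrite natrM; field.
rewrite /midpoint_sum (eq_bigr (fun j : 'I_N => (x + y * a) + y * u * rc (node N j))).
  by rewrite big_split /= sumr_const card_ord -mulr_sumr S -mulr_natr; field.
by move=> j _; ring.
Qed.

Lemma boundary_sum_affine (x y : C) a u v N : (0 < N)%N ->
  boundary_sum (fun z => x + y * z) a u v N = 0.
Proof. by move=> N0; rewrite /boundary_sum !midpoint_sum_affine //; field. Qed.

Lemma midpoint_sumD g1 g2 a u N :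
  midpoint_sum (fun z => g1 z + g2 z) a u N = midpoint_sum g1 a u N + midpoint_sum g2 a u N.
Proof. by rewrite /midpoint_sum big_split /= mulrDr. Qed.

Lemma boundary_sumD g1 g2 a u v N :
  boundary_sum (fun z => g1 z + g2 z) a u v N = boundary_sum g1 a u v N + boundary_sum g2 a u v N.
Proof. by rewrite /boundary_sum !midpoint_sumD; ring. Qed.

Lemma midpoint_sum_le g a u N (B : R) : 
  (forall t : R, 0 <= t <= 1 -> cmod (g (a + u * rc t)) <= B) ->
  cmod (midpoint_sum g a u N) <= cmod u * B.
Proof.
move=> gB; case: N => [|N].
  have B0 : 0 <= B by apply: le_trans (gB 0 _); rewrite ?cmod_ge0 // lexx ler01.
  by rewrite /midpoint_sum big_ord0 mulr0 cmod0 mulr_ge0 // cmod_ge0.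
rewrite /midpoint_sum cmodM cmodM cmodV cmod_nat -mulrA ler_wpM2l ?cmod_ge0 //.
rewrite ler_pdivrMl ?ltr0Sn //; apply: le_trans (cmod_sum _ _ _) _.
apply: le_trans (ler_sum _ (_ : forall i : 'I_N.+1, true -> _ <= B)) _.
  by move=> i _; apply: gB; rewrite node_ge0 node_le1.
by rewrite sumr_const card_ord mulr_natl.
Qed.

(** Near a point of differentiability [g] is affine up to [o(|z - w|)], and
    affine functions contribute nothing: boundary sums over small
    parallelograms near [w] are negligible with respect to their squared size.
    The
    factor [4] leaves room for the rate of convergence in [cplx_geom_lim]. *)
Lemma boundary_sum_small g w : derivable g w 1 -> forall e : R, 0 < e ->
  exists2 d : R, 0 < d & forall a u v N, (0 < N)%N ->
    cmod (a - w) <= 4 * (cmod u + cmod v) -> cmod u + cmod v < d ->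
    cmod (boundary_sum g a u v N) <= e * (cmod u + cmod v) ^+ 2.
Proof.
move=> /derivable_linear_approx[l gl] e e0.
have [d d0 H] := gl (e / 10) ltac:(by rewrite divr_gt0).
exists (d / 5); first by rewrite divr_gt0.
move=> a u v N N0 aw; set p := cmod u + cmod v => pd.
have u0 := cmod_ge0 u; have v0 := cmod_ge0 v.
pose r z := g z - g w - l * (z - w).
have -> : boundary_sum g a u v N = boundary_sum r a u v N.
  have -> : g = (fun z => r z + ((g w - l * w) + l * z)).
    by apply/funext => z; rewrite /r; ring.
  rewrite boundary_sumD boundary_sum_affine // addr0.
  by congr (boundary_sum _ a u v N); apply/funext => z; rewrite /r; ring.
have near z : cmod (z - a) <= p -> cmod (r z) <= e / 10 * (5 * p).
  move=> za; have zw : cmod (z - w) <= 5 * p.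
    have -> : z - w = (z - a) + (a - w) by ring.
    by apply: le_trans (cmodD _ _) _; rewrite /p in za aw *; lra.
  apply: le_trans (H z _) _; first by apply: le_lt_trans zw _; lra.
  by rewrite ler_wpM2l // divr_ge0 // ltW.
have seg (x : C) (t : R) : 0 <= t <= 1 -> cmod (x * rc t) <= cmod x.
  by move=> /andP[t0 t1]; rewrite cmodM cmod_rc ger0_norm // ler_piMr // cmod_ge0.
pose B := e / 10 * (5 * p).
have M1 : cmod (midpoint_sum r a u N) <= cmod u * B.
  apply: midpoint_sum_le => t /(seg u t) ht; apply: near.
  by rewrite addrC addKr /p; lra.
have M2 : cmod (midpoint_sum r (a + u) v N) <= cmod v * B.
  apply: midpoint_sum_le => t /(seg v t) ht; apply: near.
  have -> : a + u + v * rc t - a = u + v * rc t by ring.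
  by apply: le_trans (cmodD _ _) _; rewrite /p; lra.
have M3 : cmod (midpoint_sum r (a + v) u N) <= cmod u * B.
  apply: midpoint_sum_le => t /(seg u t) ht; apply: near.
  have -> : a + v + u * rc t - a = v + u * rc t by ring.
  by apply: le_trans (cmodD _ _) _; rewrite /p; lra.
have M4 : cmod (midpoint_sum r a v N) <= cmod v * B.
  apply: midpoint_sum_le => t /(seg v t) ht; apply: near.
  by rewrite addrC addKr /p; lra.
have -> : e * p ^+ 2 = cmod u * B + cmod v * B + cmod u * B + cmod v * B.
  by rewrite /B /p; field.
rewrite /boundary_sum; apply: le_trans (cmodD _ _) _; rewrite cmodN; apply: lerD => //.
apply: le_trans (cmodD _ _) _; rewrite cmodN; apply: lerD => //.
by apply: le_trans (cmodD _ _) _; apply: lerD.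
Qed.

(** Goursat's subdivision argument.  If the sums around a parallelogram are
    not eventually small relative to its squared size, the same holds for one
    of its four quarters; iterating, such quarters shrink to a point, where
    [boundary_sum_small] gives a contradiction. *)
Lemma discrete_goursat g : (forall z, derivable g z 1) -> forall a u v (e : R), 0 < e ->
  exists M0, forall M, (M0 <= M)%N -> cmod (boundary_sum g a u v (2 ^ M)) <= e.
Proof.
move=> hg a u v e e0.
pose p := cmod u + cmod v.
have p0 : 0 <= p by rewrite addr_ge0 // cmod_ge0.
pose eta := e / (p ^+ 2 + 1).
have eta0 : 0 < eta by rewrite divr_gt0 // ltr_wpDl // sqr_ge0.
(* [ok k b]: the boundary sums of the level-[k] cell with corner [b] are
   eventually at most [eta] times the squared size of the cell; this bound is
   additive under subdivision. *)
pose ok k b := exists M0, forall M, (M0 <= M)%N ->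
  cmod (boundary_sum g b (u / 2 ^+ k) (v / 2 ^+ k) (2 ^ M)) <= eta * (p / 2 ^+ k) ^+ 2.
suff [M0 H] : ok 0%N a.
  exists M0 => M hM; have := H M hM; rewrite expr0 !divr1 => /le_trans; apply.
  rewrite /eta mulrAC ler_pdivrMr ?ltr_wpDl ?sqr_ge0 //.
  by rewrite ler_wpM2l ?lerDl // ltW.
apply: contrapT => bad0.
have cmod_half x k : cmod (x / 2 ^+ k) = cmod x / 2 ^+ k.
  by rewrite cmodM cmodV cmodX cmod_nat.
have step (kb : nat * C) : exists c, ~ ok kb.1 kb.2 ->
    ~ ok kb.1.+1 c /\ cmod (c - kb.2) <= p / 2 ^+ kb.1.
  case: kb => k b /=; have [okb|nokb] := pselect (ok k b); first by exists 0.
  have hE x : x / 2 ^+ k / 2 = x / 2 ^+ k.+1 :> C.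
    by rewrite exprS; field; rewrite expf_neq0 ?pnatr_eq0.
  set u' := u / 2 ^+ k.+1; set v' := v / 2 ^+ k.+1.
  have uv : cmod u' + cmod v' = p / 2 ^+ k.+1 by rewrite !cmod_half -mulrDl.
  have uv2 : p / 2 ^+ k.+1 <= p / 2 ^+ k.
    rewrite exprS invfM ler_wpM2l // ler_piMl ?invr_ge0 ?exprn_ge0 //.
    by rewrite invf_le1 // ler1n.
  have u'0 := cmod_ge0 u'; have v'0 := cmod_ge0 v'.
  have [h1|] := pselect (ok k.+1 b); last first.
    by exists b; split => //; rewrite subrr cmod0 divr_ge0 ?exprn_ge0.
  have [h2|] := pselect (ok k.+1 (b + u')); last first.
    by exists (b + u'); split => //; rewrite addrC addKr; lra.
  have [h3|] := pselect (ok k.+1 (b + v')); last first.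
    by exists (b + v'); split => //; rewrite addrC addKr; lra.
  have [h4|] := pselect (ok k.+1 (b + u' + v')); last first.
    exists (b + u' + v'); split => //.
    have -> : b + u' + v' - b = u' + v' by ring.
    by apply: le_trans (cmodD _ _) _; lra.
  case: nokb.
  have [[M1 h1'] [M2 h2'] [M3 h3'] [M4 h4']] := And4 h1 h2 h3 h4.
  exists (maxn (maxn M1 M2) (maxn M3 M4)).+1 => -[//|M].
  rewrite ltnS !geq_max => /andP[/andP[l1 l2] /andP[l3 l4]].
  rewrite expnS mul2n -addnn boundary_sum_double !hE.
  have -> : eta * (p / 2 ^+ k) ^+ 2 = 
    eta * (p / 2 ^+ k.+1) ^+ 2 + eta * (p / 2 ^+ k.+1) ^+ 2
    + eta * (p / 2 ^+ k.+1) ^+ 2 + eta * (p / 2 ^+ k.+1) ^+ 2.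
    by rewrite (exprS 2 k); field; rewrite expf_neq0 ?pnatr_eq0.
  apply: le_trans (cmodD _ _) _; apply: lerD; last exact: h4'.
  apply: le_trans (cmodD _ _) _; apply: lerD; last exact: h3'.
  by apply: le_trans (cmodD _ _) _; apply: lerD; [exact: h1'|exact: h2'].
have [F hF] := choice step.
pose b := fix b k := if k is k'.+1 then F (k', b k') else a.
have badb k : ~ ok k (b k).
  by elim: k => [|k IH] //=; have [] := hF (k, b k) IH.
have [w hw] := @cplx_geom_lim _ b p (fun k => (hF (k, b k) (badb k)).2).
have [d d0 H] := boundary_sum_small (hg w) eta0.
have [k hk] : exists k : nat, p / 2 ^+ k < d.
  have [|n0 /(_ n0 (leqnn _)) h] := @geometric_eventually_lt R 2^-1 p d _ d0.
    by rewrite invr_ge0 ler0n invf_lt1 // ltr1n.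
  by exists n0; rewrite -exprVn.
apply: (badb k); exists 0%N => M _.
have uvk : cmod (u / 2 ^+ k) + cmod (v / 2 ^+ k) = p / 2 ^+ k.
  by rewrite !cmod_half -mulrDl.
rewrite -uvk; apply: H; rewrite ?expn_gt0 // uvk //.
by rewrite cmodB mulrA; exact: hw.
Qed.

End Goursat.

(** * Compactness in the plane *)

Section Compactness.
Variable R : realType.
Local Notation C := (Cplx R).

(** Compactness as a uniformity principle: a property that holds eventually,
    uniformly near each point of [K], holds eventually on all of [K]. *)
Lemma compact_eventually (K : set C) (P : nat -> C -> Prop) : compact K ->
  (forall z, K z -> exists d : R, exists n0, 0 < d /\ forall w n,
    cmod (w - z) < d -> (n0 <= n)%N -> P n w) ->
  exists n0, forall n z, (n0 <= n)%N -> K z -> P n z.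
Proof.
move=> /compact_near_coveringP cK locP.
have [z Kz|n0 _ H] := cK nat \oo P _; last by exists n0 => n z hn; exact: H.
have [d [n0 [d0 hP]]] := locP z Kz.
exists ([set w : C | cmod (w - z) < d], [set n | (n0 <= n)%N]) => /=.
  by split; [apply/nbhs_cmodP; exists d|exists n0].
by move=> [w n] /= [wz hn]; exact: hP.
Qed.

Lemma box_compact (r : R) :
  compact [set z : C | (`|complex.Re z| <= r) && (`|complex.Im z| <= r)].
Proof.
pose j (p : R * R) : C := Complex p.1 p.2.
have -> : [set z : C | (`|complex.Re z| <= r) && (`|complex.Im z| <= r)] =
    j @` (`[- r, r] `*` `[- r, r]).
  apply/seteqP; split => [[x y] /=|_ [[x y] /= [hx hy] <-]] /=.
    by rewrite !ler_norml => /andP[hx hy]; exists (x, y) => //=; rewrite !in_itv.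
  by move: hx hy; rewrite !in_itv /= !ler_norml => -> ->.
apply: continuous_compact; last first.
  by apply: compact_setX; exact: segment_compact.
apply: continuous_subspaceT => -[x y] A /nbhs_cmodP[e e0 he].
apply/nbhs_ballP; exists (e / 2) => /=; first by rewrite divr_gt0.
move=> [x' y'] [/= hx hy]; apply: he.
apply: le_lt_trans (cmod_le_ReIm _) _ => /=.
move: hx hy; rewrite /ball /= (distrC x) (distrC y) => hx hy.
by apply: lt_le_trans (ltrD hx hy) _; lra.
Qed.

(** The disc is contained in a compact box, whose points have modulus at most
    [2 * r]. *)
Lemma disc_eventually (r : R) (P : nat -> C -> Prop) :
  (forall z, cmod z <= 2 * r -> exists d : R, exists n0, 0 < d /\ forall w n,
    cmod (w - z) < d -> (n0 <= n)%N -> P n w) ->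
  exists n0, forall n z, (n0 <= n)%N -> cmod z <= r -> P n z.
Proof.
move=> h; have [z /= /andP[zx zy]|n0 H] :=
  @compact_eventually _ P (box_compact (r := r)).
  by apply: h; apply: le_trans (cmod_le_ReIm z) _; lra.
exists n0 => n z hn zr; apply: H => //=.
by rewrite (le_trans (Re_le_cmod _) zr) (le_trans (Im_le_cmod _) zr).
Qed.

Lemma compact_cmod_le (K : set C) : compact K ->
  exists r : nat, forall z, K z -> cmod z <= r%:R.
Proof.
move=> cK; have [z _|n0 H] := @compact_eventually K (fun n w => cmod w <= n%:R) cK; last first.
  by exists n0 => z; exact: H.
exists 1, (Num.bound (cmod z + 1)); split => // w n wz hn.
have -> : w = (w - z) + z by ring.
apply: le_trans (cmodD _ _) _.
have := archi_boundP (addr_ge0 (cmod_ge0 z) ler01).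
have : ((Num.bound (cmod z + 1))%:R : R) <= n%:R by rewrite ler_nat.
by move: wz; lra.
Qed.

Variable f : C -> C.
Hypothesis fd : forall z, derivable f z 1.

Lemma derivable_cont z (e : R) : 0 < e -> exists2 d : R, 0 < d &
  forall w, cmod (w - z) < d -> cmod (f w - f z) < e.
Proof.
move=> e0; have [l hl] := derivable_linear_approx (@fd z); have [d d0 H] := hl 1 ltr01.
have l0 := cmod_ge0 l.
have L0 : 0 < cmod l + 1 by rewrite ltr_wpDl.
exists (Num.min d (e / (cmod l + 1))).
  by rewrite lt_min d0 divr_gt0.
move=> w; rewrite lt_min ltr_pdivlMr // => /andP[wd we].
have -> : f w - f z = (f w - f z - l * (w - z)) + l * (w - z) by ring.
apply: le_lt_trans (cmodD _ _) _; apply: le_lt_trans we.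
by rewrite [leRHS]mulrDr mulr1 addrC cmodM mulrC lerD2l; have := H w wd; rewrite mul1r.
Qed.

Lemma disc_bounded (r : R) : exists2 B : R, 0 < B & forall z, cmod z <= r -> cmod (f z) <= B.
Proof.
have [z _|n0 H] := @disc_eventually r (fun n w => cmod (f w) <= n.+1%:R); last first.
  by exists n0.+1%:R => // z; exact: H.
have [d d0 hd] := derivable_cont z ltr01.
exists d, (Num.bound (cmod (f z))); split => // w n wz hn.
have -> : f w = (f w - f z) + f z by ring.
apply: le_trans (cmodD _ _) _.
have := archi_boundP (cmod_ge0 (f z)).
have : ((Num.bound (cmod (f z)))%:R : R) <= n%:R by rewrite ler_nat.
by rewrite -natr1; move: (hd _ wz); lra.
Qed.

Lemma disc_ucont (r e : R) : 0 < e -> exists2 d : R, 0 < d &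
  forall z h, cmod z <= r -> cmod h < d -> cmod (f (z + h) - f z) <= e.
Proof.
move=> e0.
have [z _|n0 H] := @disc_eventually r (fun n w =>
    forall h, cmod h < n.+1%:R^-1 -> cmod (f (w + h) - f w) <= e); last first.
  by exists n0.+1%:R^-1; rewrite ?invr_gt0 // => z h zr; exact: H.
have [d d0 hd] := derivable_cont z (divr_gt0 e0 (ltr0Sn _ 1)).
have d20 : 0 < d / 2 by rewrite divr_gt0.
exists (d / 2), (Num.bound (d / 2)^-1); split => // w n wz hn h hh.
have -> : f (w + h) - f w = (f (w + h) - f z) + (f z - f w) by ring.
apply: le_trans (cmodD _ _) _; rewrite (cmodB (f z)).
have h1 : cmod (f w - f z) < e / 2 by apply: hd; lra.
suff h2 : cmod (f (w + h) - f z) < e / 2 by lra.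
apply: hd; have -> : w + h - z = (w - z) + h by ring.
apply: le_lt_trans (cmodD _ _) _.
suff nd : n.+1%:R^-1 <= d / 2.
  by have := ltrD wz (lt_le_trans hh nd); lra.
have B : (d / 2)^-1 <= n.+1%:R.
  apply: le_trans (ltW (archi_boundP _)) _; first by rewrite invr_ge0 ltW.
  by rewrite ler_nat; apply: leq_trans hn _.
by rewrite -[leRHS]invrK lef_pV2 // posrE ?invr_gt0.
Qed.

End Compactness.

(** * Landau sums *)

Section Landau.
Variable R : realType.
Local Notation C := (Cplx R).

(** Sampling points of [-1, 1], and the values there of the Landau kernel
    [(1 - x ^ 2) ^ n]. *)
Definition abscissa (N j : nat) : R := 2 * node R N j - 1.
Definition weight n (N j : nat) : R := (1 - abscissa N j ^+ 2) ^+ n.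
Definition total_weight n N : R := \sum_(j < N) weight n N j.

Lemma abscissa_bound N j : (j < N)%N -> `|abscissa N j| <= 1.
Proof.
by move=> jN; rewrite ler_norml /abscissa; have := node_ge0 R N j; have := node_le1 R jN; lra.
Qed.

Lemma weight_base N j : (j < N)%N -> 0 <= 1 - abscissa N j ^+ 2 <= 1.
Proof.
move=> /abscissa_bound h; rewrite gerBl sqr_ge0 andbT subr_ge0 -real_normK ?num_real //.
by rewrite expr_le1.
Qed.

Lemma weight_ge0 n N j : (j < N)%N -> 0 <= weight n N j.
Proof. by move=> /weight_base/andP[h _]; rewrite exprn_ge0. Qed.

(** Only the [2 ^ q] samples in [(0, 2 ^ - m]] are kept, where the kernel is at
    least [(1 - 4 ^ - m) ^ n].  The number of samples is [2 ^ (m + q + 1)], so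
    this is a fixed proportion of them. *)
Lemma total_weight_ge m q n :
  (2 ^ q)%:R * (1 - (2 ^+ m)^-1 ^+ 2) ^+ n <= total_weight n (2 ^ (m + q).+1).
Proof.
set N := (2 ^ (m + q).+1)%N.
have NE : N = (2 ^ (m + q) + 2 ^ (m + q))%N by rewrite /N expnS mul2n -addnn.
have qN : (2 ^ q <= 2 ^ (m + q))%N by rewrite leq_exp2l // leq_addl.
rewrite /total_weight -(big_mkord xpredT (weight n N)).
have h1 : (2 ^ (m + q) <= N)%N by rewrite NE leq_addr.
have h2 : (2 ^ (m + q) + 2 ^ q <= N)%N by rewrite NE leq_add2l.
have h3 : (2 ^ (m + q) <= 2 ^ (m + q) + 2 ^ q)%N by rewrite leq_addr.
rewrite (big_cat_nat (leq0n _) h1) (big_cat_nat h3 h2) /=.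
have nonneg a b : (b <= N)%N -> 0 <= \sum_(a <= j < b) weight n N j.
  move=> bN; rewrite big_nat_cond sumr_ge0 // => j /andP[/andP[_ jb] _].
  by apply: weight_ge0; apply: leq_trans jb bN.
apply: le_trans
  (_ : \sum_((2 ^ (m + q))%N <= j < (2 ^ (m + q) + 2 ^ q)%N) weight n N j <= _); last first.
  by rewrite addrCA lerDl addr_ge0 // nonneg.
rewrite -[X in \sum_(X <= _ < _) _]add0n big_addn addKn big_mkord.
apply: le_trans (ler_sum _ (_ : forall i : 'I_(2 ^ q), true -> (1 - (2 ^+ m)^-1 ^+ 2) ^+ n <= _)).
  by rewrite sumr_const card_ord mulr_natl.
move=> i _; rewrite /weight.
have m1 : (2 ^+ m)^-1 <= 1 :> R by rewrite invf_le1 ?exprn_gt0 // exprn_ege1 // ler1n.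
have m0 : 0 <= (2 ^+ m)^-1 :> R by rewrite invr_ge0 exprn_ge0.
have xE : abscissa N (i + 2 ^ (m + q))%N = (2 * i + 1)%:R / (2 ^ (m + q).+1)%:R.
  rewrite /abscissa /node -/N NE addnn -mul2n !(natrM, natrD, natrX).
  by field; rewrite expf_neq0 ?pnatr_eq0.
have x0 : 0 <= abscissa N (i + 2 ^ (m + q))%N by rewrite xE divr_ge0.
have x1 : abscissa N (i + 2 ^ (m + q))%N <= (2 ^+ m)^-1.
  rewrite xE ler_pdivrMr ?ltr0n ?expn_gt0 // -addnS expnD natrM natrX
    mulKf ?expf_neq0 ?pnatr_eq0 //.
  by rewrite ler_nat expnS addn1 ltn_pmul2l.
apply: lerXn2r; rewrite ?nnegrE ?subr_ge0 ?lerD2l ?lerN2.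
- by rewrite expr_le1.
- by rewrite expr_le1 //; apply: le_trans m1.
- by apply: lerXn2r; rewrite ?nnegrE.
Qed.

Lemma cmod_pow_lip (M : R) (a b : C) n : 1 <= M -> cmod a <= M -> cmod b <= M ->
  cmod (a ^+ n - b ^+ n) <= n%:R * M ^+ n * cmod (a - b).
Proof.
move=> M1 aM bM; have M0 : 0 <= M by apply: le_trans M1.
elim: n => [|n IH]; first by rewrite subrr cmod0 mul0r mul0r.
have -> : a ^+ n.+1 - b ^+ n.+1 = a * (a ^+ n - b ^+ n) + b ^+ n * (a - b).
  by rewrite !exprS; ring.
apply: le_trans (cmodD _ _) _; rewrite !cmodM cmodX.
have d0 := cmod_ge0 (a - b).
have h1 : cmod a * cmod (a ^+ n - b ^+ n) <= M * (n%:R * M ^+ n * cmod (a - b)).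
  by apply: ler_pM => //; exact: cmod_ge0.
have h2 : cmod b ^+ n * cmod (a - b) <= M * M ^+ n * cmod (a - b).
  rewrite ler_wpM2r //; apply: le_trans (_ : M ^+ n <= _).
    by apply: lerXn2r; rewrite ?nnegrE ?cmod_ge0.
  by rewrite ler_peMl // exprn_ge0.
rewrite exprS -natr1 !mulrDl mul1r; apply: lerD => //.
by apply: le_trans h1 _; rewrite !mulrA [M * n%:R]mulrC.
Qed.

Variable f : C -> C.
Variable T : R.
Hypothesis T0 : 0 < T.

(** Landau's kernel is the [n]-th power of this function. *)
Definition landau_kernel (u : C) : C := 1 - (u / rc T) ^+ 2.
Definition sample N j : C := rc (T * abscissa N j).

(** The average of [f] against the kernel centred at the variable; it is a
    polynomial because the kernel is one. *)
Definition landau n N : {poly C} :=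
  \sum_(j < N) (f (sample N j) / rc (total_weight n N))%:P *
     (1 - (((rc T)^-1)%:P * ('X - (sample N j)%:P)) ^+ 2) ^+ n.

Lemma landauE n N z : (landau n N).[z] =
  (\sum_(j < N) f (sample N j) * landau_kernel (z - sample N j) ^+ n) / rc (total_weight n N).
Proof.
rewrite /landau horner_sum mulr_suml; apply: eq_bigr => j _.
rewrite hornerM hornerC horner_exp !hornerE /landau_kernel /= mulrAC.
by rewrite [(rc T)^-1 * _]mulrC.
Qed.

Let RT0 : rc T != 0. Proof. by rewrite -cmod_eq0 cmod_rc normr_eq0 gt_eqF. Qed.

Lemma landau_kernel_sample N j : landau_kernel (- sample N j) = rc (1 - abscissa N j ^+ 2).
Proof.
rewrite /landau_kernel /sample; move: (abscissa N j) => x; rewrite rcM mulNr sqrrN rcD rcN rcX.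
by congr (1 - _ ^+ 2); field.
Qed.

Lemma cmod_sample N j : (j < N)%N -> cmod (sample N j) <= T.
Proof.
by move=> /abscissa_bound h; rewrite cmod_rc normrM gtr0_norm // ler_piMr // ltW.
Qed.

(** The kernel vanishes at distance [T] from its centre, so it stays away from
    its maximum on the two sides parallel to [z]: there it equals
    [+-2 y - y ^ 2] with [|y| <= 1 / 4], and [2 / 4 + 1 / 16 = 9 / 16]. *)
Lemma landau_kernel_side (s : C) (w : C) : s = 1 \/ s = -1 -> cmod w <= T / 4 ->
  cmod (landau_kernel (w - s * rc T)) <= 9 / 16.
Proof.
move=> hs wT; pose y := w / rc T.
have yT : cmod y <= 4^-1.
  by rewrite cmodM cmodV cmod_rc gtr0_norm // ler_pdivrMr // mulrC.
have -> : landau_kernel (w - s * rc T) = s * (y + y) - y ^+ 2.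
  rewrite /landau_kernel /y; have -> : (w - s * rc T) / rc T = w / rc T - s by field.
  by case: hs => ->; ring.
apply: le_trans (cmodD _ _) _; rewrite cmodN cmodM cmodX.
have -> : cmod s = 1 by case: hs => ->; rewrite ?cmodN cmod1.
rewrite mul1r; have := cmodD y y; have := cmod_ge0 y; nra.
Qed.

(** Goursat's contour: the sum over the segment centred at [0] is the sum over
    the segment centred at [z], up to the boundary sum of the parallelogram and
    the sums over its two other sides. *)
Lemma landau_shift n N z : (0 < N)%N ->
  \sum_(j < N) f (sample N j) * landau_kernel (z - sample N j) ^+ n =
  \sum_(j < N) f (z + sample N j) * rc (weight n N j)
  + N%:R / rc (2 * T) *
    (boundary_sum (fun x => f x * landau_kernel (z - x) ^+ n) (- rc T) (rc (2 * T)) z N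
     + midpoint_sum (fun x => f x * landau_kernel (z - x) ^+ n) (- rc T) z N
     - midpoint_sum (fun x => f x * landau_kernel (z - x) ^+ n) (rc T) z N).
Proof.
move=> N0; have n0 : (N%:R : C) != 0 by rewrite pnatr_eq0 -lt0n.
set g := (fun x : C => f x * landau_kernel (z - x) ^+ n).
have T20 : rc (2 * T) != 0 by rewrite rcM mulf_neq0 // rc_nat pnatr_eq0.
have ptE j : - rc T + rc (2 * T) * rc (node R N j) = sample N j.
  by rewrite /sample /abscissa -rcM -rcN -rcD; congr rc; ring.
have E1 : midpoint_sum g (- rc T) (rc (2 * T)) N =
    rc (2 * T) / N%:R * \sum_(j < N) f (sample N j) * landau_kernel (z - sample N j) ^+ n.
  by rewrite /midpoint_sum; congr (_ * _); apply: eq_bigr => j _; rewrite ptE.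
have E2 : midpoint_sum g (- rc T + z) (rc (2 * T)) N =
    rc (2 * T) / N%:R * \sum_(j < N) f (z + sample N j) * rc (weight n N j).
  rewrite /midpoint_sum; congr (_ * _); apply: eq_bigr => j _.
  rewrite -[- rc T + z]addrC -addrA ptE /g.
  have -> : z - (z + sample N j) = - sample N j by ring.
  by rewrite landau_kernel_sample -rcX.
have E3 : - rc T + rc (2 * T) = rc T by rewrite -rcN -rcD; congr rc; ring.
rewrite /boundary_sum E1 E2 E3; set S1 := \sum_(j < N) _; set S2 := \sum_(j < N) _.
by field; rewrite n0.
Qed.

End Landau.

Section Approximation.
Variable R : realType.
Local Notation C := (Cplx R).
Variable f : C -> C.
Hypothesis fd : forall z, derivable f z 1.
Variable T B : R.
Hypothesis T0 : 0 < T.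
Hypothesis B0 : 0 < B.
Hypothesis fB : forall z, cmod z <= 2 * T -> cmod (f z) <= B.

Let rT : cmod (rc T) = T. Proof. by rewrite cmod_rc gtr0_norm. Qed.
Let RT0 : rc T != 0. Proof. by rewrite -cmod_eq0 rT gt_eqF. Qed.

Lemma landau_integrand_derivable n z w :
  derivable (fun x => f x * landau_kernel T (z - x) ^+ n) w 1.
Proof.
have -> : (fun x => f x * landau_kernel T (z - x) ^+ n) =
    f * (cst 1 - (((rc T)^-1 \*: (cst z - id)) ^+ 2)) ^+ n.
  apply/funext => x; rewrite /landau_kernel !fctE /=; congr (_ * (1 - _ ^+ 2) ^+ n).
  by rewrite [RHS]mulrC.
apply: derivableM => //; apply: derivableX; apply: derivableB.
Qed.

Lemma side_sum_le n N s z : s = 1 \/ s = -1 -> cmod z <= T / 4 ->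
  cmod (midpoint_sum (fun x => f x * landau_kernel T (z - x) ^+ n) (s * rc T) z N) <=
  cmod z * (B * (9 / 16) ^+ n).
Proof.
move=> hs zT; apply: midpoint_sum_le => t /andP[t0 t1].
have cs : cmod s = 1 by case: hs => ->; rewrite ?cmodN cmod1.
have z0 := cmod_ge0 z.
rewrite cmodM cmodX; apply: ler_pM; rewrite ?exprn_ge0 ?cmod_ge0 //.
  apply: fB; apply: le_trans (cmodD _ _) _; rewrite !cmodM cs rT cmod_rc ger0_norm //.
  have : cmod z * t <= cmod z by rewrite ler_piMr.
  by lra.
apply: lerXn2r; rewrite ?nnegrE ?cmod_ge0 //; first by lra.
have -> : z - (s * rc T + z * rc t) = z * rc (1 - t) - s * rc T.
  by rewrite rcD rcN; ring.
apply: landau_kernel_side => //; apply: le_trans zT.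
by rewrite cmodM cmod_rc ger0_norm ?ler_piMr //; lra.
Qed.

(** Approximate identity: samples within [d] of the centre change [f] by at
    most [e], and the others carry an exponentially small weight. *)
Lemma line_sum_le n N z (d e : R) : 0 < d <= T -> 0 <= e -> cmod z <= T ->
  (forall h, cmod h < d -> cmod (f (z + h) - f z) <= e) ->
  cmod (\sum_(j < N) (f (z + sample T N j) - f z) * rc (weight R n N j)) <=
  e * total_weight R n N + N%:R * (2 * B * (1 - (d / T) ^+ 2) ^+ n).
Proof.
move=> /andP[d0 dT] e0 zT hd; apply: le_trans (cmod_sum _ _ _) _.
have -> : N%:R * (2 * B * (1 - (d / T) ^+ 2) ^+ n) =
    \sum_(j < N) 2 * B * (1 - (d / T) ^+ 2) ^+ n.
  by rewrite sumr_const card_ord mulr_natl.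
rewrite /total_weight mulr_sumr -big_split /=; apply: ler_sum => j _.
have w0 := weight_ge0 R n (ltn_ord j).
have dT1 : (d / T) ^+ 2 <= 1.
  by rewrite expr_le1 ?ler_pdivrMr ?mul1r // divr_ge0 // ltW.
have s0 : 0 <= 2 * B * (1 - (d / T) ^+ 2) ^+ n.
  by rewrite !mulr_ge0 ?exprn_ge0 // ?subr_ge0 // ltW.
rewrite cmodM cmod_rc ger0_norm //.
have [near|far] := ltP (cmod (sample T N j)) d.
  apply: le_trans (_ : e * weight R n N j <= _); last by rewrite lerDl.
  by rewrite ler_wpM2r // hd.
apply: le_trans (_ : 2 * B * (1 - (d / T) ^+ 2) ^+ n <= _); last first.
  by rewrite lerDr mulr_ge0.
have pT := cmod_sample T0 (ltn_ord j).
apply: ler_pM => //; first exact: cmod_ge0.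
  apply: le_trans (cmodD _ _) _; rewrite cmodN.
  have h1 : cmod (f z) <= B by apply: fB; lra.
  have h2 : cmod (f (z + sample T N j)) <= B.
    by apply: fB; apply: le_trans (cmodD _ _) _; lra.
  lra.
rewrite /weight; have /andP[b0 _] := weight_base R (ltn_ord j).
apply: lerXn2r; rewrite ?nnegrE ?(subr_ge0 ((d / T) ^+ 2)) //.
rewrite lerD2l lerN2 -[leRHS]real_normK ?num_real //.
apply: lerXn2r; rewrite ?nnegrE ?divr_ge0 ?(ltW d0) ?(ltW T0) //.
rewrite ler_pdivrMr //; apply: le_trans far _.
by rewrite /sample cmod_rc normrM gtr0_norm // mulrC.
Qed.

(** The error terms are, in this order: near samples, far samples, the two sides
    parallel to [z], and the boundary sum. *)
Lemma landau_error n N z (d e : R) : (0 < N)%N -> 0 < total_weight R n N ->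
  0 < d <= T -> 0 <= e -> cmod z <= T / 4 ->
  (forall h, cmod h < d -> cmod (f (z + h) - f z) <= e) ->
  cmod ((landau f T n N).[z] - f z) <= e + N%:R / total_weight R n N *
    (2 * B * (1 - (d / T) ^+ 2) ^+ n + 4^-1 * B * (9 / 16) ^+ n +
     cmod (boundary_sum (fun x => f x * landau_kernel T (z - x) ^+ n)
       (- rc T) (rc (2 * T)) z N) / (2 * T)).
Proof.
move=> N0 m0 dT e0 zT hd.
have zT' : cmod z <= T by have := cmod_ge0 z; lra.
have L := line_sum_le n N dT e0 zT' hd.
have S1 := side_sum_le n N (or_intror erefl : -1 = 1 \/ -1 = -1 :> C) zT.
have S2 := side_sum_le n N (or_introl erefl : 1 = 1 \/ 1 = -1 :> C) zT.
rewrite mulN1r in S1; rewrite mul1r in S2.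
have rm0 : rc (total_weight R n N) != 0 by rewrite -cmod_eq0 cmod_rc gtr0_norm // gt_eqF.
have ms : rc (total_weight R n N) = \sum_(j < N) rc (weight R n N j).
  by apply: (big_ind2 (fun s t => rc s = t)) => // ? ? ? ? <- <-; rewrite rcD.
have -> : f z = (\sum_(j < N) f z * rc (weight R n N j)) / rc (total_weight R n N).
  by rewrite -mulr_sumr -ms mulfK.
rewrite landauE landau_shift // -mulrBl addrAC -sumrB.
rewrite (eq_bigr (fun j : 'I_N => (f (z + sample T N j) - f z) * rc (weight R n N j))); last first.
  by move=> j _; rewrite mulrBl.
move: L S1 S2; set g := (fun x => _).
set Li := \sum_(j < N) _; set s1 := midpoint_sum _ _ _ _; set s2 := midpoint_sum _ _ _ _.
set P := boundary_sum _ _ _ _ _ => L S1 S2.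
rewrite cmodM cmodV cmod_rc (gtr0_norm m0) ler_pdivrMr // [leRHS]mulrDl.
have -> : N%:R / total_weight R n N * (2 * B * (1 - (d / T) ^+ 2) ^+ n + 4^-1 * B * (9 / 16) ^+ n +
      cmod P / (2 * T)) * total_weight R n N = N%:R * (2 * B * (1 - (d / T) ^+ 2) ^+ n) +
      N%:R * (4^-1 * B * (9 / 16) ^+ n + cmod P / (2 * T)).
  by field; rewrite !gt_eqF.
rewrite addrA; apply: le_trans (cmodD _ _) _; apply: lerD => //.
rewrite !cmodM cmodV cmod_nat cmod_rc gtr0_norm ?mulr_gt0 // -mulrA ler_wpM2l //.
rewrite mulrC ler_pdivrMr ?mulr_gt0 // mulrDl divfK ?mulf_neq0 ?gt_eqF //.
have q0 : 0 <= B * (9 / 16) ^+ n by rewrite mulr_ge0 ?exprn_ge0 // ?ltW //; lra.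
apply: le_trans (cmodD _ _) _; rewrite cmodN.
have h := cmodD P s1.
have h1 : cmod z * (B * (9 / 16) ^+ n) <= T / 4 * (B * (9 / 16) ^+ n) by rewrite ler_wpM2r.
have -> : 4^-1 * B * (9 / 16) ^+ n * (2 * T) =
    T / 4 * (B * (9 / 16) ^+ n) + T / 4 * (B * (9 / 16) ^+ n).
  by field.
lra.
Qed.

(** A Lipschitz constant that does not depend on the number of samples, up to
    the ratio [N / total_weight]: it turns convergence at each point into
    uniform convergence on discs. *)
Lemma landau_lip n N z w : 0 < total_weight R n N -> cmod z <= T / 2 -> cmod w <= T / 2 ->
  cmod ((landau f T n N).[w] - (landau f T n N).[z]) <=
  N%:R / total_weight R n N * (B * (n%:R * 4 ^+ n * (3 / T))) * cmod (w - z).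
Proof.
move=> m0 zT wT; rewrite !landauE -mulrBl -sumrB cmodM cmodV cmod_rc (gtr0_norm m0).
rewrite ler_pdivrMr //.
have -> : N%:R / total_weight R n N * (B * (n%:R * 4 ^+ n * (3 / T))) *
    cmod (w - z) * total_weight R n N =
   \sum_(j < N) B * (n%:R * 4 ^+ n * (3 / T * cmod (w - z))).
  by rewrite sumr_const card_ord -[RHS]mulr_natl; field; rewrite !gt_eqF.
apply: le_trans (cmod_sum _ _ _) _; apply: ler_sum => j _.
have pT := cmod_sample T0 (ltn_ord j); move: (sample T N j) pT => s pT.
have kb x : cmod x <= T / 2 -> cmod (landau_kernel T (x - s)) <= 4.
  move=> xT; rewrite /landau_kernel; apply: le_trans (cmodD _ _) _.
  rewrite cmod1 cmodN cmodX cmodM cmodV rT.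
  have : cmod (x - s) / T <= 3 / 2.
    rewrite ler_pdivrMr //; apply: le_trans (cmodD _ _) _; rewrite cmodN. lra.
  have : 0 <= cmod (x - s) / T by rewrite divr_ge0 ?cmod_ge0 // ltW.
  by nra.
rewrite -mulrBr cmodM; apply: ler_pM; rewrite ?cmod_ge0 //.
  by apply: fB; apply: le_trans pT _; rewrite ler_peMl ?(ltW T0) ?ler1n.
apply: le_trans (cmod_pow_lip n _ (kb _ wT) (kb _ zT)) _; first by lra.
rewrite ler_wpM2l ?mulr_ge0 ?exprn_ge0 //.
have -> : landau_kernel T (w - s) - landau_kernel T (z - s) =
    (z - w) * (z + w - (s + s)) / rc T ^+ 2.
  by rewrite /landau_kernel; field.
rewrite !cmodM cmodV cmodX rT (cmodB z w).
have h : cmod (z + w - (s + s)) <= 3 * T.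
  apply: le_trans (cmodD _ _) _; rewrite cmodN.
  by have := cmodD z w; have := cmodD s s; lra.
have -> : 3 / T * cmod (w - z) = cmod (w - z) * (3 * T) / T ^+ 2 by field; rewrite gt_eqF.
by rewrite ler_wpM2r ?invr_ge0 ?sqr_ge0 // ler_wpM2l ?cmod_ge0.
Qed.

End Approximation.

(** First the power [n] is fixed: the number [m] of halvings is chosen so that
    [(1 - 4 ^ - m) ^ n], the lower bound for the total weight, dominates both
    [(9 / 16) ^ n] and the weight [(1 - (d / T) ^ 2) ^ n] of the far samples.
    Then the mesh is refined: at each point [discrete_goursat] makes the
    boundary sum negligible, and [landau_lip] with compactness makes this
    uniform. *)
Lemma poly_approx (R : realType) (f : Cplx R -> Cplx R) (r e : R) :
  (forall z, derivable f z 1) -> 0 < e ->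
  exists p : {poly Cplx R}, forall z, cmod z <= r -> cmod (p.[z] - f z) <= e.
Proof.
move=> fd e0.
pose r1 : R := 2 * `|r| + 1; pose T : R := 4 * r1.
have r10 : 0 < r1 by rewrite ltr_wpDl // mulr_ge0.
have T0 : 0 < T by rewrite mulr_gt0.
have r1T : r1 = T / 4 by rewrite /T; field.
have [B B0 fB] := disc_bounded fd (2 * T).
pose e4 := e / 4; have e40 : 0 < e4 by rewrite divr_gt0.
have [d1 d10 hd1] := disc_ucont fd r1 e40.
pose d := Num.min d1 T.
have d0 : 0 < d by rewrite lt_min d10.
have dT : 0 < d <= T by rewrite d0 ge_min lexx orbT.
have hd z h : cmod z <= r1 -> cmod h < d -> cmod (f (z + h) - f z) <= e4.
  by move=> zr; rewrite lt_min => /andP[hh _]; exact: hd1.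
have [|m /(_ m (leqnn _)) hm] := @geometric_eventually_lt R 2^-1 (2 * T) d _ d0.
  by rewrite invr_ge0 ler0n invf_lt1 // ltr1n.
rewrite exprVn in hm; set mu := (2 ^+ m)^-1 in hm.
have mu0 : 0 < mu by rewrite invr_gt0 exprn_gt0.
pose t : R := d / T.
have t0 : 0 < t by rewrite divr_gt0.
have t1 : t <= 1 by rewrite ler_pdivrMr // mul1r; case/andP: dT.
have mut : 2 * mu < t by rewrite ltr_pdivlMr // mulrAC.
(* [2 * mu < t] separates the base [rho] of the total weight from the base
   [sig] of the far samples: [rho = 1 - mu ^ 2 > 1 - 4 mu ^ 2 > sig]. *)
pose rho : R := 1 - mu ^+ 2.
have rho34 : 3 / 4 <= rho by rewrite /rho; nra.
pose sig : R := 1 - t ^+ 2.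
have sig0 : 0 <= sig by rewrite /sig; nra.
have sigrho : sig < rho by rewrite /sig /rho; nra.
pose Q := Num.max (9 / 16) sig.
have Q0 : 0 <= Q by rewrite le_max sig0 orbT.
have Qrho : Q < rho by rewrite gt_max sigrho andbT; lra.
have rho0 : 0 < rho by apply: le_lt_trans Qrho.
have [|n /(_ n (leqnn _)) hn] := @geometric_eventually_lt R
    (Q / rho) (2 ^+ m.+1 * (2 * B + 4^-1 * B)) e4 _ e40.
  by rewrite divr_ge0 ?(ltW rho0) // ltr_pdivrMr // mul1r.
pose N q := (2 ^ (m + q).+1)%N.
have N0 q : (0 < N q)%N by rewrite expn_gt0.
have M0 q : 0 < total_weight R n (N q).
  apply: lt_le_trans (total_weight_ge R m q n).
  by rewrite mulr_gt0 ?ltr0n ?expn_gt0 // exprn_gt0.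
(* [L] bounds the normalising factor uniformly in the number of samples. *)
pose L := 2 ^+ m.+1 / rho ^+ n.
have L0 : 0 < L by rewrite divr_gt0 ?exprn_gt0.
have NL q : (N q)%:R / total_weight R n (N q) <= L.
  rewrite ler_pdivrMr // /L mulrAC ler_pdivlMr ?exprn_gt0 //.
  have -> : (N q)%:R = 2 ^+ m.+1 * (2 ^ q)%:R :> R by rewrite /N -addSn expnD natrM natrX.
  by rewrite -mulrA ler_wpM2l ?exprn_ge0 // total_weight_ge.
have NL0 q : 0 <= (N q)%:R / total_weight R n (N q) by rewrite divr_ge0 // ltW.
pose p q := landau f T n (N q).
have ptw z : cmod z <= r1 -> exists q0, forall q, (q0 <= q)%N ->
    cmod ((p q).[z] - f z) <= e4 + e4 + e4.
  move=> zr.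
  have gd := @landau_integrand_derivable R f fd T n z.
  have [|q0 hq0] := discrete_goursat gd (- rc T) (rc (2 * T)) z (e := e4 * (2 * T) / L).
    by rewrite divr_gt0 // mulr_gt0 // mulr_gt0.
  exists q0 => q hq; rewrite r1T in zr.
  have := landau_error T0 B0 fB (N0 q) (M0 q) dT (ltW e40) zr _.
  rewrite -r1T in zr; move=> /(_ (fun h => hd z h zr)) /le_trans; apply.
  rewrite -[leRHS]addrA lerD2l.
  set g := boundary_sum _ _ _ _ _.
  have hg : cmod g <= e4 * (2 * T) / L.
    by apply: hq0; apply: leq_trans hq _; rewrite leqW // leq_addl.
  have g0 : 0 <= cmod g / (2 * T) by rewrite divr_ge0 ?cmod_ge0 // ltW // mulr_gt0.
  have sQ : sig ^+ n <= Q ^+ n by apply: lerXn2r; rewrite ?nnegrE // le_max lexx orbT.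
  have qQ : (9 / 16) ^+ n <= Q ^+ n.
    by apply: lerXn2r; rewrite ?nnegrE // ?le_max ?lexx //; lra.
  have s0 : 0 <= sig ^+ n by rewrite exprn_ge0.
  have q90 : 0 <= (9 / 16) ^+ n :> R by rewrite exprn_ge0 //; lra.
  have BB : 0 <= 4^-1 * B by apply: mulr_ge0; [lra|exact: ltW].
  have B2 : 0 <= 2 * B by apply: mulr_ge0; [lra|exact: ltW].
  rewrite -/t -/sig mulrDr; apply: lerD.
    apply: le_trans (_ : L * ((2 * B + 4^-1 * B) * Q ^+ n) <= _).
      apply: ler_pM => //; first by apply: addr_ge0; apply: mulr_ge0.
      by rewrite [leRHS] mulrDl; apply: lerD; rewrite ler_wpM2l.
    have <- : 2 ^+ m.+1 * (2 * B + 4^-1 * B) * (Q / rho) ^+ n =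
        L * ((2 * B + 4^-1 * B) * Q ^+ n).
      by rewrite /L expr_div_n; field; rewrite expf_neq0 // gt_eqF.
    exact: ltW.
  apply: le_trans (_ : L * (cmod g / (2 * T)) <= _); first by rewrite ler_wpM2r.
  have T20 : 0 < 2 * T by apply: mulr_gt0.
  by rewrite mulrA ler_pdivrMr // mulrC -ler_pdivlMr.
pose Lip := L * (B * (n%:R * 4 ^+ n * (3 / T))).
have BT : 0 <= B * (n%:R * 4 ^+ n * (3 / T)).
  apply: mulr_ge0; first exact: ltW.
  by apply: mulr_ge0; [rewrite mulr_ge0 // exprn_ge0|rewrite divr_ge0 // ltW].
have Lip0 : 0 <= Lip by apply: mulr_ge0 => //; exact: ltW.
have lip q z w : cmod z <= T / 2 -> cmod w <= T / 2 ->
    cmod ((p q).[w] - (p q).[z]) <= Lip * cmod (w - z).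
  move=> zT wT; apply: le_trans (landau_lip T0 fB (M0 q) zT wT) _.
  by rewrite ler_wpM2r ?cmod_ge0 // ler_wpM2r.
have [z zr|q0 hq0] := @disc_eventually R `|r| (fun q w => cmod ((p q).[w] - f w) <= e).
  have zr1 : cmod z <= r1 by rewrite /r1; lra.
  have [q0 hq0] := ptw z zr1.
  have e8 : 0 < e / 8 by rewrite divr_gt0.
  have [d2 d20 hd2] := derivable_cont fd z e8.
  have s0 : 0 < e / 8 / (Lip + 1) by rewrite divr_gt0 // ltr_wpDl.
  exists (Num.min d2 (Num.min r1 (e / 8 / (Lip + 1)))), q0; split.
    by rewrite !lt_min d20 r10.
  move=> w q; rewrite !lt_min => /and3P[wd wr wL] hq.
  have wzr : cmod w <= 2 * r1.
    have -> : w = (w - z) + z by ring.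
    by apply: le_trans (cmodD _ _) _; lra.
  have := lip q z w; have -> : T / 2 = 2 * r1 by rewrite /T; field.
  move=> /(_ _ wzr) lipzw.
  have {}lipzw : cmod ((p q).[w] - (p q).[z]) <= e / 8.
    apply: le_trans (lipzw _) _; first lra.
    move: wL; rewrite ltr_pdivlMr ?ltr_wpDl // mulrDr mulr1 mulrC.
    by have := cmod_ge0 (w - z); lra.
  have -> : (p q).[w] - f w = (((p q).[w] - (p q).[z]) + ((p q).[z] - f z)) + (f z - f w).
    by ring.
  have h1 := hd2 w wd; have h2 := hq0 q hq.
  apply: le_trans (cmodD _ _) _; rewrite (cmodB (f z)).
  apply: le_trans (lerD (cmodD _ _) (lexx _)) _.
  by rewrite /e4 in h2; lra.
exists (p q0) => z zr; apply: hq0 => //; apply: le_trans zr _; exact: ler_norm.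
Qed.

(** * Coefficient norms, jet interpolation and series of polynomials *)

Section PolyNorm.
Variable R : realType.
Local Notation C := (Cplx R).
Implicit Types (p q : {poly C}) (rho : R).

Definition coef_norm rho p : R := \sum_(i < size p) cmod p`_i * rho ^+ i.

Lemma coef_norm_wide rho p N : (size p <= N)%N ->
  coef_norm rho p = \sum_(i < N) cmod p`_i * rho ^+ i.
Proof.
move=> pN; rewrite /coef_norm (big_ord_widen N (fun i => cmod p`_i * rho ^+ i)) //.
rewrite big_mkcond; apply: eq_bigr => i _; case: ltnP => // h.
by rewrite nth_default // cmod0 mul0r.
Qed.

Lemma coef_norm0 rho : coef_norm rho 0 = 0.
Proof. by rewrite /coef_norm size_poly0 big_ord0. Qed.

Lemma coef_norm_ge0 rho p : 0 <= rho -> 0 <= coef_norm rho p.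
Proof. by move=> r0; apply: sumr_ge0 => i _; rewrite mulr_ge0 ?exprn_ge0 ?cmod_ge0. Qed.

Lemma coef_normD rho p q : 0 <= rho ->
  coef_norm rho (p + q) <= coef_norm rho p + coef_norm rho q.
Proof.
move=> r0; set N := maxn (size p) (size q).
rewrite (@coef_norm_wide _ p N) ?leq_maxl // (@coef_norm_wide _ q N) ?leq_maxr //.
rewrite (@coef_norm_wide _ _ N) ?size_polyD // -big_split /=.
apply: ler_sum => i _; rewrite coefD -mulrDl ler_wpM2r ?exprn_ge0 //; exact: cmodD.
Qed.

Lemma coef_normZ rho (c : C) p : coef_norm rho (c *: p) = cmod c * coef_norm rho p.
Proof.
rewrite (@coef_norm_wide _ _ (size p)) ?size_scale_leq // /coef_norm mulr_sumr.
by apply: eq_bigr => i _; rewrite coefZ cmodM mulrA.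
Qed.

Lemma coef_normXM rho p : coef_norm rho ('X * p) = rho * coef_norm rho p.
Proof.
rewrite (@coef_norm_wide _ _ (size p).+1); last first.
  by apply: leq_trans (size_polyMleq _ _) _; rewrite size_polyX.
rewrite big_ord_recl coefXM eqxx cmod0 mul0r add0r /coef_norm mulr_sumr.
by apply: eq_bigr => i _; rewrite coefXM /= exprS mulrCA.
Qed.

Lemma coef_normXnM rho n p : coef_norm rho ('X^n * p) = rho ^+ n * coef_norm rho p.
Proof.
by elim: n => [|n IH]; rewrite ?expr0 ?mul1r // !exprS -mulrA coef_normXM IH mulrA.
Qed.

Lemma coef_norm_le rho rho' p : 0 <= rho <= rho' -> coef_norm rho p <= coef_norm rho' p.
Proof.
move=> /andP[r0 rr]; apply: ler_sum => i _; rewrite ler_wpM2l ?cmod_ge0 //.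
by apply: lerXn2r; rewrite ?nnegrE // (le_trans r0).
Qed.

Lemma cmod_horner_le rho p z : cmod z <= rho -> cmod p.[z] <= coef_norm rho p.
Proof.
move=> zr; rewrite horner_coef; apply: le_trans (cmod_sum _ _ _) _.
apply: ler_sum => i _; rewrite cmodM cmodX ler_wpM2l ?cmod_ge0 //.
by apply: lerXn2r; rewrite ?nnegrE ?cmod_ge0 // (le_trans (cmod_ge0 z)).
Qed.

Lemma mulrn_expr_pred (A : pzSemiRingType) (x : A) i :
  i%:R * x ^+ i.-1 * x = i%:R * x ^+ i.
Proof. by case: i => [|i]; rewrite ?mul0r // -mulrA -exprSr. Qed.

(** The right-hand side is the left-hand side at [z = rho], [h = 1], up to the
    factor [|h| ^ 2]: both satisfy the same recurrence, with nonnegative terms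
    on the right. *)
Lemma monomial_taylor rho (z h : C) i : 0 <= rho -> cmod z <= rho -> cmod h <= 1 ->
  cmod ((z + h) ^+ i - z ^+ i - h * (i%:R * z ^+ i.-1)) <=
  cmod h ^+ 2 * ((rho + 1) ^+ i - rho ^+ i - i%:R * rho ^+ i.-1).
Proof.
move=> r0 zr h1; elim: i => [|i IH].
  by rewrite !expr0 !mul0r mulr0 !subr0 !subrr cmod0 mulr0.
have -> : (z + h) ^+ i.+1 - z ^+ i.+1 - h * (i.+1%:R * z ^+ i) =
    (z + h) * ((z + h) ^+ i - z ^+ i - h * (i%:R * z ^+ i.-1)) + h ^+ 2 * (i%:R * z ^+ i.-1).
  have E := mulrn_expr_pred z i; rewrite -natr1 !exprS expr0.
  transitivity ((z + h) * (z + h) ^+ i - z * z ^+ i - h * (z ^+ i) - h * (i%:R * z ^+ i)).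
    by ring.
  by rewrite -E; ring.
have -> : (rho + 1) ^+ i.+1 - rho ^+ i.+1 - i.+1%:R * rho ^+ i =
    (rho + 1) * ((rho + 1) ^+ i - rho ^+ i - i%:R * rho ^+ i.-1) + i%:R * rho ^+ i.-1.
  have E := mulrn_expr_pred rho i; rewrite -natr1 !exprS.
  transitivity ((rho + 1) * (rho + 1) ^+ i - rho * rho ^+ i - rho ^+ i - i%:R * rho ^+ i).
    by ring.
  by rewrite -E; ring.
rewrite [leRHS]mulrDr; apply: le_trans (cmodD _ _) _; apply: lerD.
  rewrite cmodM [leRHS]mulrCA; apply: ler_pM => //; rewrite ?cmod_ge0 //.
  by apply: le_trans (cmodD _ _) _; apply: lerD.
rewrite cmodM cmodX ler_wpM2l ?exprn_ge0 ?cmod_ge0 // cmodM cmod_nat cmodX ler_wpM2l //.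
by apply: lerXn2r; rewrite ?nnegrE ?cmod_ge0.
Qed.

Lemma bernoulli_mono rho i : 0 <= rho -> rho ^+ i + i%:R * rho ^+ i.-1 <= (rho + 1) ^+ i.
Proof.
move=> r0; have := @monomial_taylor rho 0 1 i r0; rewrite cmod0 cmod1 expr1n mul1r.
by move=> /(_ r0 (lexx _)) /(le_trans (cmod_ge0 _)); lra.
Qed.

Lemma deriv_hornerE p z :
  p^`().[z] = \sum_(i < size p) p`_i * (i%:R * z ^+ i.-1).
Proof.
rewrite /deriv horner_poly; case: (size p) => [|m]; first by rewrite !big_ord0.
rewrite big_ord_recl /= mul0r mulr0 add0r; apply: eq_bigr => i _.
by rewrite mulrA mulr_natr.
Qed.

Lemma horner_taylor rho p z h : 0 <= rho -> cmod z <= rho -> cmod h <= 1 ->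
  cmod (p.[z + h] - p.[z] - h * p^`().[z]) <= cmod h ^+ 2 * coef_norm (rho + 1) p.
Proof.
move=> r0 zr h1; rewrite deriv_hornerE !horner_coef mulr_sumr -!sumrB.
apply: le_trans (cmod_sum _ _ _) _; rewrite /coef_norm mulr_sumr; apply: ler_sum => i _.
have -> : p`_i * (z + h) ^+ i - p`_i * z ^+ i - h * (p`_i * (i%:R * z ^+ i.-1)) =
    p`_i * ((z + h) ^+ i - z ^+ i - h * (i%:R * z ^+ i.-1)) by ring.
rewrite cmodM [leRHS]mulrCA ler_wpM2l ?cmod_ge0 //.
apply: le_trans (monomial_taylor i r0 zr h1) _.
rewrite ler_wpM2l ?exprn_ge0 ?cmod_ge0 //.
have := exprn_ge0 i r0; have : 0 <= i%:R * rho ^+ i.-1 by rewrite mulr_ge0 // exprn_ge0.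
lra.
Qed.

(** Enlarging the radius by one absorbs the factor [i] in the derivative of the
    [i]-th power, by Bernoulli's inequality. *)
Lemma coef_norm_deriv rho p : 0 <= rho -> coef_norm rho p^`() <= coef_norm (rho + 1) p.
Proof.
move=> r0; rewrite (@coef_norm_wide _ _ (size p).-1) ?size_poly // /coef_norm.
case E : (size p) => [|m]; first by rewrite !big_ord0.
rewrite big_ord_recl /= -[leLHS]add0r; apply: lerD.
  by rewrite mulr_ge0 ?cmod_ge0 // expr0.
apply: ler_sum => i _; rewrite coef_deriv -mulr_natr cmodM cmod_nat -mulrA.
rewrite ler_wpM2l ?cmod_ge0 //; apply: le_trans (bernoulli_mono i.+1 r0).
by rewrite lerDr exprn_ge0.
Qed.

Lemma coef_norm_derivn rho p m : 0 <= rho -> coef_norm rho p^`(m) <= coef_norm (rho + m%:R) p.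
Proof.
move=> r0; elim: m rho r0 => [|m IH] rho r0; first by rewrite addr0.
rewrite derivnS; apply: le_trans (coef_norm_deriv _ r0) _.
by apply: le_trans (IH _ _) _; rewrite ?addr_ge0 // -addrA nat1r.
Qed.

Lemma cmod_horner_derivn_le rho p m z :
  cmod z + m%:R <= rho -> cmod p^`(m).[z] <= coef_norm rho p.
Proof.
move=> zm; apply: le_trans (cmod_horner_le _ (lexx (cmod z))) _.
apply: le_trans (coef_norm_derivn _ _ (cmod_ge0 z)) _; apply: coef_norm_le.
by rewrite zm addr_ge0 // cmod_ge0.
Qed.

Lemma derivn_rootM (a : C) d (S : {poly C}) k : (k <= d)%N ->
  (('X - a%:P) ^+ d * S)^`(k).[a] = if k == d then S.[a] * d`!%:R else 0.
Proof.
elim: d S k => [|d IH] S [|k] // kd.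
- by rewrite derivn0 expr0 mul1r mulr1.
- by rewrite derivn0 hornerM horner_exp !hornerE subrr expr0n /= mul0r.
rewrite derivSn.
have -> : (('X - a%:P) ^+ d.+1 * S)^`() =
    ('X - a%:P) ^+ d * (d.+1%:R%:P * S + ('X - a%:P) * S^`()).
  rewrite derivM deriv_exp derivXsubC mul1r -mulr_natl polyC_natr /= exprSr; ring.
rewrite IH // eqSS; case: eqP => // _.
rewrite hornerD !hornerM !hornerE subrr mul0r addr0 factS natrM; ring.
Qed.

(** The last derivative is corrected by a multiple of [X ^ N (X - a) ^ d], which
    leaves the lower ones unchanged; as [rho < |a|], a large [N] makes this
    correction as small as needed. *)
Lemma jet_interp d rho (a : C) (w : nat -> C) (e : R) : 0 <= rho < cmod a -> 0 < e ->
  exists2 q, coef_norm rho q <= e & forall k, (k < d)%N -> q^`(k).[a] = w k.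
Proof.
move=> /andP[r0 ra]; elim: d e => [|d IH] e e0.
  by exists 0 => //; rewrite coef_norm0 ltW.
have [q qe qw] := IH (e / 2) (divr_gt0 e0 (ltr0Sn _ 1)).
have a0 : a != 0 by rewrite -cmod_gt0; apply: le_lt_trans ra.
have ca0 : 0 < cmod a by rewrite cmod_gt0.
have fR : (d`!%:R : R) != 0 by rewrite pnatr_eq0 -lt0n fact_gt0.
have fC : (d`!%:R : C) != 0 by rewrite pnatr_eq0 -lt0n fact_gt0.
pose c N : C := (w d - q^`(d).[a]) / (a ^+ N * d`!%:R).
pose D := cmod (w d - q^`(d).[a]) / d`!%:R * coef_norm rho (('X - a%:P) ^+ d).
have [|N /(_ N (leqnn N)) hN] := @geometric_eventually_lt R
    (rho / cmod a) D (e / 2) _ (divr_gt0 e0 (ltr0Sn _ 1)).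
  by rewrite divr_ge0 ?cmod_ge0 //= ltr_pdivrMr // mul1r.
exists (q + c N *: ('X^N * ('X - a%:P) ^+ d)).
  apply: le_trans (coef_normD _ _ r0) _; rewrite coef_normZ coef_normXnM.
  suff : cmod (c N) * (rho ^+ N * coef_norm rho (('X - a%:P) ^+ d)) <= e / 2 by lra.
  have <- : D * (rho / cmod a) ^+ N =
      cmod (c N) * (rho ^+ N * coef_norm rho (('X - a%:P) ^+ d)); last exact: ltW.
  rewrite /D /c !cmodM cmodV cmodM cmodX cmod_nat expr_div_n; field.
  by rewrite fR expf_neq0 ?gt_eqF.
move=> k kd; rewrite derivnD derivnZ hornerD hornerZ [_ * ('X - _) ^+ d]mulrC.
rewrite derivn_rootM // hornerXn; case: eqP => [->|/eqP kd'].
  have nz : a ^+ N * d`!%:R != 0 by apply: mulf_neq0 => //; exact: expf_neq0.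
  by rewrite /c divfK // addrC subrK.
by rewrite mulr0 addr0 qw // ltn_neqAle kd' -ltnS.
Qed.

(** If the increments of [P] are small on discs whose radii grow linearly, all
    derivatives of [P N] converge locally uniformly, and the limits [G m] are
    successive derivatives: the quadratic Taylor bounds of the [P N] have
    uniformly bounded constants, so they pass to the limit.  The rank where
    approximation starts is explicit, since the jet of the limit has to be
    compared with a single [P N] at a point tied to [N]. *)
Lemma polynomial_series_limit (P : nat -> {poly C}) (s : nat) (e : R) : (0 < s)%N ->
  (forall N, coef_norm (s * N.+1)%:R (P N.+1 - P N) <= e / 2 ^+ N) ->
  exists G : nat -> C -> C,
    (forall m z N, cmod z + m%:R <= (s * N.+1)%:R ->
       cmod (G m z - (P N)^`(m).[z]) <= 4 * e / 2 ^+ N) /\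
    (forall m z, exists2 M : R, 0 <= M & forall h, cmod h <= 1 ->
       cmod (G m (z + h) - G m z - h * G m.+1 z) <= cmod h ^+ 2 * M).
Proof.
move=> s0 hP.
have e0 : 0 <= e.
  have := hP 0%N; rewrite expr0 divr1; apply: le_trans; exact: coef_norm_ge0.
have ex_rad (x : R) : exists N, x <= (s * N.+1)%:R.
  exists (Num.bound x); have [x0|x0] := leP x 0; first by apply: le_trans x0 _.
  apply: le_trans (ltW (archi_boundP (ltW x0))) _.
  by rewrite ler_nat; apply: leq_trans (leqnSn _) _; rewrite leq_pmull.
have rad_mono N k : (s * N.+1)%:R <= (s * (k + N).+1)%:R :> R.
  by rewrite ler_nat leq_mul2l ltnS leq_addl orbT.
have exG (mz : nat * C) : exists w, forall N, cmod mz.2 + mz.1%:R <= (s * N.+1)%:R ->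
    cmod (w - (P N)^`(mz.1).[mz.2]) <= 4 * e / 2 ^+ N.
  case: mz => m z /=.
  have [N0 hN0 minN0] := ex_minnP (ex_rad (cmod z + m%:R)).
  have [k|w hw] := @cplx_geom_lim _ (fun k => (P (k + N0)%N)^`(m).[z]) (e / 2 ^+ N0).
    rewrite -hornerN -hornerD -derivnN -derivnD.
    have -> : e / 2 ^+ N0 / 2 ^+ k = e / 2 ^+ (k + N0).
      by rewrite exprD; field; rewrite !expf_neq0 ?pnatr_eq0.
    apply: le_trans (hP (k + N0)%N); apply: cmod_horner_derivn_le.
    exact: le_trans hN0 (rad_mono _ _).
  exists w => N hN; have := hw (N - N0)%N; rewrite subnK ?minN0 //.
  have -> : 4 * (e / 2 ^+ N0) / 2 ^+ (N - N0) = 4 * e / 2 ^+ N; last by [].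
  rewrite -[in RHS](subnK (minN0 _ hN)) exprD.
  by field; rewrite !expf_neq0 ?pnatr_eq0.
have [G0 hG0] := choice exG; pose G m z := G0 (m, z).
have hG m z N : cmod z + m%:R <= (s * N.+1)%:R ->
       cmod (G m z - (P N)^`(m).[z]) <= 4 * e / 2 ^+ N by exact: (hG0 (m, z)).
exists G; split => // m z.
(* Radius needed for [m + 1] derivatives on the unit disc around [z]. *)
pose rho := cmod z + 1 + m.+1%:R.
have rho0 : 0 <= rho by rewrite !addr_ge0 // cmod_ge0.
have [N0 hN0] := ex_rad rho.
pose M := coef_norm rho (P N0) + 2 * e.
have bound k : coef_norm rho (P (k + N0)%N) <=
    coef_norm rho (P N0) + 2 * e - 2 * e / 2 ^+ (k + N0).
  elim: k => [|k IH].
    rewrite add0n; have : e / 2 ^+ N0 <= e; last by lra.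
    by rewrite ler_pdivrMr ?exprn_gt0 // ler_peMr // exprn_ege1 // ler1n.
  rewrite addSn; set N := (k + N0)%N in IH *.
  have -> : P N.+1 = P N + (P N.+1 - P N) by ring.
  apply: le_trans (coef_normD _ _ rho0) _.
  have h : coef_norm rho (P N.+1 - P N) <= e / 2 ^+ N.
    apply: le_trans (hP N); apply: coef_norm_le; rewrite rho0 /=.
    exact: le_trans hN0 (rad_mono _ _).
  have : 2 * e / 2 ^+ N.+1 = e / 2 ^+ N by rewrite exprS; field; rewrite expf_neq0 ?pnatr_eq0.
  lra.
exists M; first by rewrite addr_ge0 ?coef_norm_ge0 // mulr_ge0.
move=> h h1; apply/ler_addgt0Pr => eps eps0.
have [|k /(_ k (leqnn _)) hk] := @geometric_eventually_lt R 2^-1 (12 * e) eps _ eps0.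
  by rewrite invr_ge0 ler0n invf_lt1 // ltr1n.
set N := (k + N0)%N; set p := (P N)^`(m).
have rN : rho <= (s * N.+1)%:R by apply: le_trans hN0 (rad_mono _ _).
have h0 := cmod_ge0 h.
have mS : m.+1%:R = m%:R + 1 :> R by rewrite -natr1.
have g1 : cmod (G m (z + h) - p.[z + h]) <= 4 * e / 2 ^+ N.
  by apply: hG; apply: le_trans rN; have := cmodD z h; rewrite /rho; lra.
have g2 : cmod (p.[z] - G m z) <= 4 * e / 2 ^+ N.
  by rewrite cmodB; apply: hG; apply: le_trans rN; rewrite /rho; lra.
have g3 : cmod (p^`().[z] - G m.+1 z) <= 4 * e / 2 ^+ N.
  by rewrite cmodB -derivnS; apply: hG; apply: le_trans rN; rewrite /rho; lra.
have g4 : cmod (p.[z + h] - p.[z] - h * p^`().[z]) <= cmod h ^+ 2 * M.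
  apply: le_trans (horner_taylor _ (cmod_ge0 z) (lexx _) h1) _.
  rewrite ler_wpM2l ?exprn_ge0 //.
  have z10 : 0 <= cmod z + 1 by rewrite addr_ge0 // cmod_ge0.
  apply: le_trans (coef_norm_derivn _ _ z10) _.
  apply: le_trans (coef_norm_le _ (_ : 0 <= _ <= rho)) _.
    by rewrite addr_ge0 //= /rho mS; lra.
  apply: le_trans (bound k) _.
  by rewrite /M lerBlDr lerDl divr_ge0 ?exprn_ge0 // mulr_ge0.
have -> : G m (z + h) - G m z - h * G m.+1 z =
   (G m (z + h) - p.[z + h]) + (p.[z] - G m z) + h * (p^`().[z] - G m.+1 z)
   + (p.[z + h] - p.[z] - h * p^`().[z]) by ring.
apply: le_trans (cmodD _ _) _; rewrite addrC; apply: lerD => //.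
have g3' : cmod (h * (p^`().[z] - G m.+1 z)) <= 4 * e / 2 ^+ N.
  by rewrite cmodM; apply: le_trans g3; rewrite ler_piMl ?cmod_ge0.
apply: le_trans (ltW hk).
have kN : e / 2 ^+ N <= e * 2^-1 ^+ k.
  rewrite exprVn ler_wpM2l // lef_pV2 ?posrE ?exprn_gt0 //.
  by rewrite /N exprD ler_peMr ?exprn_ge0 // exprn_ege1 // ler1n.
apply: le_trans (cmodD _ _) _; have := cmodD (G m (z + h) - p.[z + h]) (p.[z] - G m z).
lra.
Qed.

End PolyNorm.

(** * Vector-valued maps and dense targets *)

Section Vector.
Variable R : realType.
Local Notation C := (Cplx R).

Lemma mx_ball_cmod m n (u v : 'M[C]_(m, n)) (e : R) : 0 < e ->
  (forall i j, cmod (u i j - v i j) < e) -> ball u (rc e) v.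
Proof.
move=> e0 h; split; first by rewrite -rc0 rc_lt.
by move=> i j; apply/ball_cmod; exact: h.
Qed.

Lemma coord_derivable n (f : C -> 'rV[C]_n) z j :
  derivable f z 1 -> derivable (fun x => f x 0 j) z 1.
Proof.
move=> /cvg_ex[l hl]; apply/cvg_ex; exists (l 0 j).
have := cvg_comp _ _ hl (@coord_continuous C 1 n 0 j l).
apply: cvg_trans; apply: near_eq_cvg; near=> h; rewrite /= !mxE //.
Unshelve. all: by end_near. Qed.

(** Coordinatewise quadratic remainders with a common constant suffice for
    differentiability of a vector-valued map. *)
Lemma row_derive n (F F' : C -> 'rV[C]_n) z (M : R) : 0 <= M ->
  (forall h j, cmod h <= 1 ->
     cmod (F (z + h) 0 j - F z 0 j - h * F' z 0 j) <= cmod h ^+ 2 * M) ->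
  derivable F z 1 /\ (F^`())%classic z = F' z.
Proof.
move=> M0 H.
have lim : (fun h : C => h^-1 *: (F (h + z) - F z)) @ 0^' --> F' z.
  apply/cvg_ballP => _ /pos_cplx_real[e e0 ->].
  rewrite /nbhs /=; apply/nbhs_cmodP; exists (Num.min 1 (e / (M + 1))).
    by rewrite lt_min ltr01 divr_gt0 // ltr_wpDl.
  move=> h; rewrite subr0 lt_min => /andP[h1 he] hn0.
  apply: mx_ball_cmod => // i j; rewrite !ord1 {i} !mxE.
  have -> : F' z 0 j - h^-1 * (F (h + z) 0 j - F z 0 j) =
      - (h^-1 * (F (z + h) 0 j - F z 0 j - h * F' z 0 j)).
    by rewrite (addrC h z); field.
  have ch : 0 < cmod h by rewrite cmod_gt0.
  rewrite cmodN cmodM cmodV ltr_pdivrMl //.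
  apply: le_lt_trans (H h j (ltW h1)) _.
  rewrite expr2 -mulrA ltr_pM2l //.
  by move: he; rewrite ltr_pdivlMr ?ltr_wpDl // mulrDr mulr1; lra.
have eqf : (fun h : C => h^-1 *: ((F \o shift z) (h *: (1 : C)) - F z)) =
    (fun h : C => h^-1 *: (F (h + z) - F z)).
  by apply/funext => h /=; rewrite /GRing.scale /= mulr1.
split; last exact: cvg_lim lim.
by rewrite /derivable eqf; apply/cvg_ex; exists (F' z).
Qed.

End Vector.

Section Targets.
Variable R : realType.
Local Notation C := (Cplx R).
Variables d n : nat.

Definition ratc (x : rat * rat) : C := Complex (ratr x.1 : R) (ratr x.2).

(** Matrices with Gaussian rational entries, enumerated by the 2-adic valuation
    of [N], so that each of them occurs for arbitrarily large [N]. *)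
Definition target (N : nat) : 'M[C]_(d.+1, n) :=
  if (unpickle (logn 2 N) : option 'M[rat * rat]_(d.+1, n)) is Some A
  then map_mx ratc A else 0.

Lemma ratc_dense (z : C) (e : R) : 0 < e -> exists x, cmod (ratc x - z) < e.
Proof.
move=> e0; have e20 : 0 < e / 2 by rewrite divr_gt0.
have near_rat (x : R) : exists q : rat, `|ratr q - x| < e / 2.
  have [|q] := @rat_in_itvoo R (x - e / 2) (x + e / 2); first by lra.
  by rewrite in_itv /= => /andP[h1 h2]; exists q; rewrite ltr_norml; lra.
have [p hp] := near_rat (complex.Re z); have [q hq] := near_rat (complex.Im z).
exists (p, q); apply: le_lt_trans (cmod_le_ReIm _) _.
by case: z hp hq => a b /= hp hq; apply: lt_le_trans (ltrD hp hq) _; lra.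
Qed.

Lemma target_dense (V : 'M[C]_(d.+1, n)) (e : R) (N0 : nat) : 0 < e ->
  exists2 N, (N0 <= N)%N & forall i j, cmod (target N i j - V i j) < e.
Proof.
move=> e0; have [F hF] := choice (fun z => @ratc_dense z e e0).
pose A := map_mx F V; pose N := (2 ^ pickle A * (2 * N0 + 1))%N.
have N20 : (0 < 2 * N0 + 1)%N by rewrite addn1.
exists N.
  apply: leq_trans (leq_pmull _ (_ : 0 < 2 ^ pickle A)%N); last by rewrite expn_gt0.
  by rewrite addn1 mul2n -addnn; apply: leq_trans (leq_addr _ _) (leqnSn _).
move=> i j; rewrite /target /N lognM ?expn_gt0 // pfactorK // logn_coprime; last first.
  by rewrite coprime2n oddD oddM.
by rewrite addn0 pickleK !mxE; exact: hF.
Qed.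

End Targets.

(** * Density *)

(** The gluing construction.  The slope [s] of the radii is at least [d + 1], so
    that the [d]-jet at [a N = s (N + 1) + 1] is controlled by the corrections
    of rank larger than [N], and at least [r], so that all corrections are
    small on the given disc. *)
Lemma dense_jet_approx (R : realType) (n d : nat) (f : Cplx R -> 'rV[Cplx R]_n) (r e : R) :
  holomorphic f -> 0 < e -> exists g : Cplx R -> 'rV[Cplx R]_n,
    [/\ holomorphic g, closure (range (jet d g)) = setT &
     forall z j, cmod z <= r -> cmod (g z 0 j - f z 0 j) <= e].
Proof.
move=> hf e0.
have e20 : 0 < e / 2 by rewrite divr_gt0.
have [p0 hp0] := choice (fun j => poly_approx r (fun z => @coord_derivable R n f z j (@hf z)) e20).
pose s := (d.+1 + Num.bound `|r|)%N.
have s0 : (0 < s)%N by [].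
have rs : r <= s%:R.
  apply: le_trans (ler_norm _) _; apply: le_trans (ltW (archi_boundP (normr_ge0 _))) _.
  by rewrite ler_nat leq_addl.
(* The limit is within [4 * eps = e / 2] of the first polynomial. *)
pose eps := e / 8; have eps0 : 0 < eps by rewrite divr_gt0.
pose a N : Cplx R := (s * N.+1).+1%:R.
have aN N : (0 : R) <= (s * N.+1)%:R < cmod (a N) by rewrite cmod_nat ler0n ltr_nat ltnS leqnn.
have step (x : 'I_n * nat * {poly Cplx R}) : exists p,
    coef_norm (s * x.1.2.+1)%:R (p - x.2) <= eps / 2 ^+ x.1.2 /\
    forall k, (k < d.+1)%N -> p^`(k).[a x.1.2] = target R d n x.1.2 (inord k) x.1.1.
  case: x => [[j N] p] /=.
  have eN : 0 < eps / 2 ^+ N by rewrite divr_gt0 // exprn_gt0.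
  have [q q1 q2] := jet_interp d.+1
    (fun k => target R d n N (inord k) j - p^`(k).[a N]) (aN N) eN.
  exists (p + q); split; first by rewrite addrC addKr.
  by move=> k kd; rewrite derivnD hornerD q2 // addrC subrK.
have [F hF] := choice step.
pose P j := fix P N := if N is N'.+1 then F (j, N', P N') else p0 j.
have PS j N : coef_norm (s * N.+1)%:R (P j N.+1 - P j N) <= eps / 2 ^+ N.
  by have [] := hF (j, N, P j N).
have PJ j N k : (k < d.+1)%N -> (P j N.+1)^`(k).[a N] = target R d n N (inord k) j.
  by have [_] := hF (j, N, P j N); apply.
have [G hG] := choice (fun j => polynomial_series_limit s0 (PS j)).
have exM (x : 'I_n * nat * Cplx R) : exists M : R, 0 <= M /\ forall h, cmod h <= 1 ->
    cmod (G x.1.1 x.1.2 (x.2 + h) - G x.1.1 x.1.2 x.2 - h * G x.1.1 x.1.2.+1 x.2)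
    <= cmod h ^+ 2 * M.
  by have [M M0 MH] := (hG x.1.1).2 x.1.2 x.2; exists M.
have [M hM] := choice exM.
pose g k z := \row_j G j k z.
have gder k z : derivable (g k) z 1 /\ ((g k)^`())%classic z = g k.+1 z.
  apply: (@row_derive _ _ _ _ _ (\sum_j M (j, k, z))).
    by apply: sumr_ge0 => j _; have [] := hM (j, k, z).
  move=> h j h1; rewrite !mxE; have [_ H] := hM (j, k, z).
  apply: le_trans (H h h1) _; rewrite ler_wpM2l ?exprn_ge0 ?cmod_ge0 //.
  rewrite (bigD1 j) //= lerDl; apply: sumr_ge0 => i _.
  by have [] := hM (i, k, z).
have gn k : ((g 0%N)^`(k))%classic = g k.
  elim: k => [|k IH]; first by rewrite derive1n0.
  by rewrite derive1nS IH; apply/funext => z; have [] := gder k z.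
exists (g 0%N); split.
- by move=> z; have [] := gder 0%N z.
- apply/seteqP; split => // v _ B /nbhs_ballP[_ /= /pos_cplx_real[e1 e10 ->] hB].
  have e120 : 0 < e1 / 2 by rewrite divr_gt0.
  have [|N1 hN1] := @geometric_eventually_lt R 2^-1 (2 * eps) (e1 / 2) _ e120.
    by rewrite invr_ge0 ler0n invf_lt1 // ltr1n.
  have [N NN1 hN] := target_dense (vec_mx v : 'M[Cplx R]_(d.+1, n)) N1 e120.
  exists (jet d (g 0%N) (a N)); split; first by exists (a N).
  apply: hB; apply: mx_ball_cmod => // i c; rewrite {i}ord1.
  have [k j] := mxvec_indexP c.
  rewrite /jet mxvecE mxE gn mxE -[v]vec_mxK mxvecE cmodB.
  have h1 : cmod (G j k (a N) - target R d n N k j) <= 4 * eps / 2 ^+ N.+1.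
    rewrite -[k in target R d n N k j]inord_val -PJ //.
    apply: (hG j).1; rewrite cmod_nat -natrD ler_nat.
    by rewrite [(s * N.+2)%N]mulnS addnC addSn -addnS leq_add2r /s;
      apply: leq_trans (ltn_ord k) (leq_addr _ _).
  have -> : G j k (a N) - vec_mx v k j =
    (G j k (a N) - target R d n N k j) + (target R d n N k j - vec_mx v k j) by ring.
  apply: le_lt_trans (cmodD _ _) _.
  have h2 := hN k j; have := hN1 N NN1; rewrite exprVn => h3.
  have : 4 * eps / 2 ^+ N.+1 = 2 * eps / 2 ^+ N.
    by rewrite exprS; field; rewrite expf_neq0 ?pnatr_eq0.
  lra.
- move=> z j zr; rewrite mxE.
  have h1 := (hG j).1 0%N z 0%N; rewrite addr0 muln1 expr0 divr1 in h1.
  have {}h1 := h1 (le_trans zr rs); have h2 := hp0 j z zr.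
  have -> : G j 0%N z - f z 0 j = (G j 0%N z - (p0 j).[z]) + ((p0 j).[z] - f z 0 j) by ring.
  apply: le_trans (cmodD _ _) _; rewrite /= /eps in h1; lra.
Qed.

(** Approximants on discs of radius [m] within [1 / (m + 1)] converge to [f]
    uniformly on compact sets, so they eventually enter any neighbourhood. *)
Theorem proposition1 (R : realType) (n d : nat) (hn : (0 < n)%N) :
  dense (@Phi R n d).
Proof.
move=> O [f Of] [O' oO' OE].
have hf : holomorphic (hol_incl f) by case: f {Of} => f /= /set_mem.
have approx (m : nat) : exists g : Cplx R -> 'rV[Cplx R]_n,
    [/\ holomorphic g, closure (range (jet d g)) = setT &
     forall z j, cmod z <= m%:R -> cmod (g z 0 j - hol_incl f z 0 j) <= m.+1%:R^-1].
  by apply: dense_jet_approx; rewrite ?invr_gt0.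
have [g hg] := choice approx.
have cvg_g : {family compact, (fun m => g m) @ \oo --> hol_incl f}.
  apply/fam_cvgP => K cK A /uniform_nbhs[E [entE EA]].
  move: entE; rewrite -entourage_ballE => -[_ /= /pos_cplx_real[e e0 ->] ballE].
  have [r hr] := compact_cmod_le cK.
  exists (maxn r (Num.bound e^-1)) => // m /=; rewrite geq_max => /andP[rm em].
  apply: EA => z Kz; apply: ballE => /=; apply: mx_ball_cmod => // i j; rewrite {i}ord1.
  have [_ _ H] := hg m; rewrite cmodB; apply: le_lt_trans (H z j _) _.
    by apply: le_trans (hr z Kz) _; rewrite ler_nat.
  rewrite invf_plt ?posrE //; apply: lt_le_trans (archi_boundP _) _.
    by rewrite invr_ge0 ltW.
  by rewrite ler_nat; apply: leq_trans em (leqnSn _).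
have O'f : nbhs (hol_incl f) O' by apply: open_nbhs_nbhs; split => //; rewrite -OE in Of.
have [m _ /(_ m (leqnn m)) /= O'g] := cvg_g O' O'f.
have [gh gd _] := hg m.
exists (exist _ (g m) (mem_set gh)); split; first by rewrite -OE.
exact: gd.
Qed.
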